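(* Let $\mathcal B\subset\mathcal C$ be cyclic operads. Assume that for every $w'\in\mathcal C(\{p',q'\}\sqcup R)$ and $w''\in\mathcal C(\{p'',q''\}\sqcup S)$ such that $w'\,{}_{q'}\circ_{q''}w''\in\mathcal B(\{p',p''\}\sqcup R\sqcup S)$, either (i) there is a bijection $\rho:\{p',p''\}\sqcup R\sqcup S\to\{q',q''\}\sqcup R\sqcup S$ fixing $R\sqcup S$ such that $w'\,{}_{p'}\circ_{p''}w''=\rho(w'\,{}_{q'}\circ_{q''}w'')$, or (ii) there are $w'_1\in\mathcal B(\{p',q'\}\sqcup R)$ and $w''_1\in\mathcal B(\{p'',q''\}\sqcup S)$ such that $w'\,{}_{p'}\circ_{p''}w''=w'_1\,{}_{p'}\circ_{p''}w''_1$ and $w'\,{}_{q'}\circ_{q''}w''=w'_1\,{}_{q'}\circ_{q''}w''_1$. Then the induced map $\varpi:\mathrm{Mod}(\mathcal B)\to\mathrm{Mod}(\mathcal C)$ is injective.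
   Context: Operads live in the category of sets and no units are required. A cyclic operad $\mathcal C$ is a functor from finite sets and bijections to sets with operations ${}_a\circ_b:\mathcal C(S_1\sqcup\{a\})\times\mathcal C(S_2\sqcup\{b\})\to\mathcal C(S_1\sqcup S_2)$ which are equivariant under bijections and satisfy $x\,{}_a\circ_by=y\,{}_b\circ_ax$ and $(x\,{}_a\circ_by)\,{}_c\circ_dz=x\,{}_a\circ_b(y\,{}_c\circ_dz)$ for $c\ne b$ an input of $y$. Elements of $S$ are called inputs of $x\in\mathcal C(S)$. $\mathcal B\subset\mathcal C$ means that $\mathcal B$ is a cyclic suboperad of $\mathcal C$. A modular operad $\mathcal M$ consists of sets $\mathcal M(S;G)$, functorial in the finite set $S$ (under bijections), with genus $G\in\mathbb N$ (or $\frac12\mathbb N$), operations ${}_a\circ_b:\mathcal M(S_1\sqcup\{a\};G_1)\times\mathcal M(S_2\sqcup\{b\};G_2)\to\mathcal M(S_1\sqcup S_2;G_1+G_2)$ which are equivariant under bijections and satisfy $x\,{}_a\circ_by=y\,{}_b\circ_ax$ and $(x\,{}_a\circ_by)\,{}_c\circ_dz=x\,{}_a\circ_b(y\,{}_c\circ_dz)$ for $c\ne b$ an input of $y$, and contractions $\circ_{uv}=\circ_{vu}:\mathcal M(S\sqcup\{u,v\};G)\to\mathcal M(S;G+1)$, equivariant and satisfying $\circ_{uv}\circ_{cd}=\circ_{cd}\circ_{uv}$; $\circ_{uv}(x\,{}_a\circ_by)=(\circ_{uv}x)\,{}_a\circ_by$ for $u,v$ inputs of $x$; $\circ_{ab}(x\,{}_c\circ_dy)=\circ_{cd}(x\,{}_a\circ_by)$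 for $a,c$ inputs of $x$ and $b,d$ inputs of $y$. $\mathrm{Mod}$, the modular completion, is the left adjoint of the functor from modular operads to cyclic operads taking $\mathcal M$ to its genus $0$ part $S\mapsto\mathcal M(S;0)$ and forgetting contractions. The map $\varpi$ is $\mathrm{Mod}$ applied to the inclusion $\mathcal B\hookrightarrow\mathcal C$; injectivity is meant componentwise. In the statement $R,S$ are arbitrary (disjoint) finite sets and $p',q',p'',q''$ distinct symbols outside them. *)

(* Defs.v *)
From mathcomp Require Import all_boot.
From mathcomp Require Import boolp.

Set Implicit Arguments.
Unset Strict Implicit.
Unset Printing Implicit Defensive.

(* Conventions.  A finite set is a [finType].  The set [S] with one new input
   adjoined is [option S], the new input being [None]; a disjoint union is a
   sum type.  An operation attached to an arbitrary input [a] of [x] is obtained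
   by first relabelling [x] so that [a] becomes [None]; equivariance makes the
   result independent of the relabelling.  The names of the inputs that are
   lost in this way are tracked by the following canonical bijections. *)

Section CanonicalBijections.
Variables A B C A' B' : Type.

Definition oswap (x : option (option A)) : option (option A) :=
  match x with
  | None => Some None
  | Some None => None
  | Some (Some a) => Some (Some a)
  end.

Definition opairswap (x : option (option (option (option A)))) :
    option (option (option (option A))) :=
  match x with
  | None => Some (Some None)
  | Some None => Some (Some (Some None))
  | Some (Some None) => None
  | Some (Some (Some None)) => Some None
  | Some (Some (Some (Some a))) => Some (Some (Some (Some a)))
  end.

Definition orot (x : option (option (option A))) : option (option (option A)) :=
  match x with
  | None => Some (Some None)
  | Some None => None
  | Some (Some None) => Some None
  | Some (Some (Some a)) => Some (Some (Some a))
  end.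

Definition outl (x : option A + B) : option (A + B) :=
  match x with
  | inl None => None
  | inl (Some a) => Some (inl a)
  | inr b => Some (inr b)
  end.

Definition outr (x : A + option B) : option (A + B) :=
  match x with
  | inl a => Some (inl a)
  | inr None => None
  | inr (Some b) => Some (inr b)
  end.

Definition sumC (x : A + B) : B + A :=
  match x with inl a => inr a | inr b => inl b end.

Definition sumA (x : (A + B) + C) : A + (B + C) :=
  match x with
  | inl (inl a) => inl a
  | inl (inr b) => inr (inl b)
  | inr c => inr (inr c)
  end.

Definition summap (f : A -> A') (g : B -> B') (x : A + B) : A' + B' :=
  match x with inl a => inl (f a) | inr b => inr (g b) end.

Lemma oswap_bij : bijective oswap.
Proof. by exists oswap => -[[a|]|]. Qed.

Lemma opairswap_bij : bijective opairswap.
Proof. by exists opairswap => -[[[[a|]|]|]|]. Qed.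

Lemma orot_bij : bijective orot.
Proof.
exists (fun x => match x with
  | None => Some None
  | Some None => Some (Some None)
  | Some (Some None) => None
  | Some (Some (Some a)) => Some (Some (Some a))
  end); by move=> [[[a|]|]|].
Qed.

Lemma outl_bij : bijective outl.
Proof.
exists (fun x => match x with
  | None => inl None
  | Some (inl a) => inl (Some a)
  | Some (inr b) => inr b
  end); by [move=> [[a|]|b] | move=> [[a|b]|]].
Qed.

Lemma outr_bij : bijective outr.
Proof.
exists (fun x => match x with
  | None => inr None
  | Some (inl a) => inl a
  | Some (inr b) => inr (Some b)
  end); by [move=> [a|[b|]] | move=> [[a|b]|]].
Qed.

Lemma sumC_bij : bijective sumC.
Proof.
by exists (fun x : B + A => match x with inl b => inr b | inr a => inl a end)
  => -[].
Qed.

Lemma sumA_bij : bijective sumA.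
Proof.
exists (fun x => match x with
  | inl a => inl (inl a)
  | inr (inl b) => inl (inr b)
  | inr (inr c) => inr c
  end); by [move=> [[a|b]|c] | move=> [a|[b|c]]].
Qed.

Lemma summap_bij (f : A -> A') (g : B -> B') :
  bijective f -> bijective g -> bijective (summap f g).
Proof.
move=> [f' fK f'K] [g' gK g'K].
exists (fun x : A' + B' => match x with
  | inl a => inl (f' a)
  | inr b => inr (g' b)
  end); by move=> [x|x] /=; rewrite ?fK ?f'K ?gK ?g'K.
Qed.

Lemma omap_bij (f : A -> A') : bijective f -> bijective (omap f).
Proof. by move=> [g fK gK]; exists (omap g) => -[x|] //=; rewrite ?fK ?gK. Qed.

End CanonicalBijections.

Arguments oswap_bij A : clear implicits.
Arguments opairswap_bij A : clear implicits.
Arguments orot_bij A : clear implicits.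
Arguments outl_bij A B : clear implicits.
Arguments outr_bij A B : clear implicits.
Arguments sumC_bij A B : clear implicits.
Arguments sumA_bij A B C : clear implicits.

Lemma outlr_bij (A B : Type) :
  bijective (fun x : option A + option B => omap (@outr A B) (outl x)).
Proof. exact: bij_comp (omap_bij (outr_bij A B)) (outl_bij A (option B)). Qed.

Lemma outll_bij (A B : Type) :
  bijective (fun x : option (option A) + B => omap (@outl A B) (outl x)).
Proof. exact: bij_comp (omap_bij (outl_bij A B)) (outl_bij (option A) B). Qed.

(* [co_map_ext] says that the action of a bijection depends only on the
   underlying function, not on the proof of bijectivity.  In [co_comp x y] the
   inputs [None] of [x] and of [y] are composed.  In [co_assoc] the
   inputs of [y] are [b = None] and [c = Some None]. *)
Record cyclic_operad := CyclicOperad {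
  co_set :> finType -> Type;
  co_map : forall (S T : finType) (f : S -> T),
    bijective f -> co_set S -> co_set T;
  co_comp : forall S1 S2 : finType,
    co_set (option S1) -> co_set (option S2) -> co_set (S1 + S2)%type;
  co_map_ext : forall (S T : finType) (f g : S -> T)
      (hf : bijective f) (hg : bijective g) (x : co_set S),
    f =1 g -> co_map hf x = co_map hg x;
  co_map_id : forall (S : finType) (h : bijective (@id S)) (x : co_set S),
    co_map h x = x;
  co_map_comp : forall (S T U : finType) (f : S -> T) (g : T -> U)
      (hf : bijective f) (hg : bijective g) (x : co_set S),
    co_map hg (co_map hf x) = co_map (bij_comp hg hf) x;
  co_comp_map : forall (S1 S2 T1 T2 : finType) (f : S1 -> T1) (g : S2 -> T2)
      (hf : bijective f) (hg : bijective g)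
      (x : co_set (option S1)) (y : co_set (option S2)),
    co_comp (co_map (omap_bij hf) x) (co_map (omap_bij hg) y) =
    co_map (summap_bij hf hg) (co_comp x y);
  co_compC : forall (S1 S2 : finType)
      (x : co_set (option S1)) (y : co_set (option S2)),
    co_map (sumC_bij S1 S2) (co_comp x y) = co_comp y x;
  co_compA : forall (S1 S2 S3 : finType) (x : co_set (option S1))
      (y : co_set (option (option S2))) (z : co_set (option S3)),
    co_map (sumA_bij S1 S2 S3)
      (co_comp (co_map (outr_bij S1 S2) (co_comp x y)) z) =
    co_comp x (co_map (outl_bij S2 S3)
      (co_comp (co_map (oswap_bij S2) y) z))
}.

Record cyclic_hom (C D : cyclic_operad) := CyclicHom {
  ch_fun :> forall S : finType, C S -> D S;
  ch_map : forall (S T : finType) (f : S -> T) (hf : bijective f) (x : C S),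
    ch_fun (co_map hf x) = co_map hf (ch_fun x);
  ch_comp : forall (S1 S2 : finType) (x : C (option S1)) (y : C (option S2)),
    ch_fun (co_comp x y) = co_comp (ch_fun x) (ch_fun y)
}.

Record cyclic_suboperad (C : cyclic_operad) := CyclicSuboperad {
  sub_mem :> forall S : finType, C S -> Prop;
  sub_map : forall (S T : finType) (f : S -> T) (hf : bijective f) (x : C S),
    sub_mem x -> sub_mem (co_map hf x);
  sub_comp : forall (S1 S2 : finType) (x : C (option S1)) (y : C (option S2)),
    sub_mem x -> sub_mem y -> sub_mem (co_comp x y)
}.

Section SuboperadAsOperad.
Variables (C : cyclic_operad) (B : cyclic_suboperad C).

Definition sub_operad : cyclic_operad.
Proof.
refine (@CyclicOperad (fun S : finType => {x : C S | B S x})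
  (fun S T f hf x => exist _ (co_map hf (sval x)) (sub_map hf (svalP x)))
  (fun S1 S2 x y =>
     exist _ (co_comp (sval x) (sval y)) (sub_comp (svalP x) (svalP y)))
  _ _ _ _ _ _).
- by move=> S T f g hf hg x fg; apply: eq_exist; exact: co_map_ext.
- by move=> S h [x Bx]; apply: eq_exist; exact: co_map_id.
- by move=> *; apply: eq_exist; exact: co_map_comp.
- by move=> *; apply: eq_exist; exact: co_comp_map.
- by move=> *; apply: eq_exist; exact: co_compC.
- by move=> *; apply: eq_exist; exact: co_compA.
Defined.

Definition sub_incl : cyclic_hom sub_operad C :=
  @CyclicHom sub_operad C (fun S x => sval x)
    (fun _ _ _ _ _ => erefl) (fun _ _ _ _ => erefl).

End SuboperadAsOperad.

(* Genera lie in N ([half = false]) or in (1/2)N ([half = true]); in the second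
   case the genus G is encoded by the natural number 2G. *)
Definition genus_one (half : bool) : nat := if half then 2 else 1.

(* [mo_contr x] contracts the inputs [None] and [Some None] of [x].  In
   [mo_contr_comp] the inputs of [x] are [a = None], [u = Some None] and
   [v = Some (Some None)]; in [mo_contr_swap] they are [c = None] and
   [a = Some None], and those of [y] are [d = None] and [b = Some None]. *)
Record modular_operad (half : bool) := ModularOperad {
  mo_set :> finType -> nat -> Type;
  mo_map : forall (S T : finType) (G : nat) (f : S -> T),
    bijective f -> mo_set S G -> mo_set T G;
  mo_comp : forall (S1 S2 : finType) (G1 G2 : nat),
    mo_set (option S1) G1 -> mo_set (option S2) G2 ->
    mo_set (S1 + S2)%type (G1 + G2);
  mo_contr : forall (S : finType) (G : nat),
    mo_set (option (option S)) G -> mo_set S (G + genus_one half);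
  mo_map_ext : forall (S T : finType) (G : nat) (f g : S -> T)
      (hf : bijective f) (hg : bijective g) (x : mo_set S G),
    f =1 g -> mo_map hf x = mo_map hg x;
  mo_map_id : forall (S : finType) (G : nat) (h : bijective (@id S))
      (x : mo_set S G),
    mo_map h x = x;
  mo_map_comp : forall (S T U : finType) (G : nat) (f : S -> T) (g : T -> U)
      (hf : bijective f) (hg : bijective g) (x : mo_set S G),
    mo_map hg (mo_map hf x) = mo_map (bij_comp hg hf) x;
  mo_comp_map : forall (S1 S2 T1 T2 : finType) (G1 G2 : nat)
      (f : S1 -> T1) (g : S2 -> T2) (hf : bijective f) (hg : bijective g)
      (x : mo_set (option S1) G1) (y : mo_set (option S2) G2),
    mo_comp (mo_map (omap_bij hf) x) (mo_map (omap_bij hg) y) =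
    mo_map (summap_bij hf hg) (mo_comp x y);
  mo_compC : forall (S1 S2 : finType) (G1 G2 : nat)
      (x : mo_set (option S1) G1) (y : mo_set (option S2) G2),
    ecast G (mo_set (S2 + S1)%type G) (addnC G1 G2)
      (mo_map (sumC_bij S1 S2) (mo_comp x y)) = mo_comp y x;
  mo_compA : forall (S1 S2 S3 : finType) (G1 G2 G3 : nat)
      (x : mo_set (option S1) G1) (y : mo_set (option (option S2)) G2)
      (z : mo_set (option S3) G3),
    mo_map (sumA_bij S1 S2 S3)
      (mo_comp (mo_map (outr_bij S1 S2) (mo_comp x y)) z) =
    ecast G (mo_set (S1 + (S2 + S3))%type G) (addnA G1 G2 G3)
      (mo_comp x (mo_map (outl_bij S2 S3)
         (mo_comp (mo_map (oswap_bij S2) y) z)));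
  mo_contr_map : forall (S T : finType) (G : nat) (f : S -> T)
      (hf : bijective f) (x : mo_set (option (option S)) G),
    mo_contr (mo_map (omap_bij (omap_bij hf)) x) = mo_map hf (mo_contr x);
  mo_contr_sym : forall (S : finType) (G : nat)
      (x : mo_set (option (option S)) G),
    mo_contr (mo_map (oswap_bij S) x) = mo_contr x;
  mo_contrC : forall (S : finType) (G : nat)
      (x : mo_set (option (option (option (option S)))) G),
    mo_contr (mo_contr (mo_map (opairswap_bij S) x)) = mo_contr (mo_contr x);
  mo_contr_comp : forall (S1 S2 : finType) (G1 G2 : nat)
      (x : mo_set (option (option (option S1))) G1)
      (y : mo_set (option S2) G2),
    ecast G (mo_set (S1 + S2)%type G) (addnAC G1 G2 (genus_one half))
      (mo_contr (mo_map (outll_bij S1 S2) (mo_comp x y))) =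
    mo_comp (mo_contr (mo_map (orot_bij S1) x)) y;
  mo_contr_swap : forall (S1 S2 : finType) (G1 G2 : nat)
      (x : mo_set (option (option S1)) G1)
      (y : mo_set (option (option S2)) G2),
    mo_contr (mo_map (outlr_bij S1 S2) (mo_comp x y)) =
    mo_contr (mo_map (outlr_bij S1 S2)
      (mo_comp (mo_map (oswap_bij S1) x) (mo_map (oswap_bij S2) y)))
}.

Record modular_hom (half : bool) (M N : modular_operad half) := ModularHom {
  mh_fun :> forall (S : finType) (G : nat), M S G -> N S G;
  mh_map : forall (S T : finType) (G : nat) (f : S -> T) (hf : bijective f)
      (x : M S G),
    mh_fun (mo_map hf x) = mo_map hf (mh_fun x);
  mh_comp : forall (S1 S2 : finType) (G1 G2 : nat)
      (x : M (option S1) G1) (y : M (option S2) G2),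
    mh_fun (mo_comp x y) = mo_comp (mh_fun x) (mh_fun y);
  mh_contr : forall (S : finType) (G : nat) (x : M (option (option S)) G),
    mh_fun (mo_contr x) = mo_contr (mh_fun x)
}.

Definition genus0 (half : bool) (M : modular_operad half) : cyclic_operad.
Proof.
refine (@CyclicOperad (fun S : finType => M S 0)
  (fun S T f hf x => mo_map hf x) (fun S1 S2 x y => mo_comp x y)
  _ _ _ _ _ _).
- by move=> *; exact: mo_map_ext.
- by move=> *; exact: mo_map_id.
- by move=> *; exact: mo_map_comp.
- by move=> S1 S2 T1 T2 f g hf hg x y; exact: (mo_comp_map hf hg x y).
- move=> S1 S2 x y; rewrite -(mo_compC x y).
  by rewrite (eq_irrelevance (addnC 0 0) erefl).
- move=> S1 S2 S3 x y z; rewrite (mo_compA x y z).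
  by rewrite (eq_irrelevance (addnA 0 0 0) erefl).
Defined.

Definition cyclic_hom_comp (C D E : cyclic_operad)
    (g : cyclic_hom D E) (f : cyclic_hom C D) : cyclic_hom C E.
Proof.
refine (@CyclicHom C E (fun S x => g S (f S x)) _ _) => *.
- by rewrite !ch_map.
- by rewrite !ch_comp.
Defined.

(* A left adjoint of [genus0], presented by its universal arrows [mc_unit];
   it is unique up to a unique isomorphism.  Its action on morphisms is
   [mc_hom] below. *)
Record modular_completion (half : bool) := ModularCompletion {
  mc_obj :> cyclic_operad -> modular_operad half;
  mc_unit : forall C : cyclic_operad, cyclic_hom C (genus0 (mc_obj C));
  mc_lift : forall (C : cyclic_operad) (N : modular_operad half),
    cyclic_hom C (genus0 N) -> modular_hom (mc_obj C) N;
  mc_lift_unit : forall (C : cyclic_operad) (N : modular_operad half)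
      (f : cyclic_hom C (genus0 N)) (S : finType) (x : C S),
    mc_lift f S 0 (mc_unit C S x) = f S x;
  mc_lift_unique : forall (C : cyclic_operad) (N : modular_operad half)
      (f : cyclic_hom C (genus0 N)) (g : modular_hom (mc_obj C) N),
    (forall (S : finType) (x : C S), g S 0 (mc_unit C S x) = f S x) ->
    forall (S : finType) (G : nat) (x : mc_obj C S G), g S G x = mc_lift f S G x
}.

Definition mc_hom (half : bool) (Mod : modular_completion half)
    (C D : cyclic_operad) (f : cyclic_hom C D) :
    modular_hom (Mod C) (Mod D) :=
  mc_lift Mod (cyclic_hom_comp (mc_unit Mod D) f).

(* For [w' : C (option (option R))], read as an element of
   C({p',q'} + R), and similarly for [w''], the inputs p', p'' are [None] and
   q', q'' are [Some None].  [comp_p w' w''] composes p' with p'' and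
   [comp_q w' w''] composes q' with q''; in the result the remaining inputs
   (q', q'', respectively p', p'') are [inl None] and [inr None]. *)
Definition comp_p (C : cyclic_operad) (R S : finType)
    (w' : C (option (option R))) (w'' : C (option (option S))) :
    C (option R + option S)%type :=
  co_comp w' w''.

Definition comp_q (C : cyclic_operad) (R S : finType)
    (w' : C (option (option R))) (w'' : C (option (option S))) :
    C (option R + option S)%type :=
  co_comp (co_map (oswap_bij R) w') (co_map (oswap_bij S) w'').

(* Main.v *)
Require Import Defs.
From mathcomp Require Import all_boot.
From mathcomp Require Import boolp.
From Stdlib Require Import Relation_Operators.

Set Implicit Arguments.
Unset Strict Implicit.
Unset Printing Implicit Defensive.

(** Every element of [Mod(C)(S)] is an iterated contraction of some
    [x : C (S + L * bool)], whose extra inputs are the half-edges of the loops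
    [L].  Two such presentations have the same value if they are linked by a
    chain of two moves: relabelling (and flipping) the loops, and the swap
    taking [w' q'oq'' w''] with loop [(p', p'')] to [w' p'op'' w''] with loop
    [(q', q'')].  Conversely the classes of presentations modulo these moves
    form a modular operad whose genus 0 part receives [C], so elements that
    agree in [Mod(C)] have presentations linked by a chain in [C].  If such a
    chain starts in [B], the hypothesis lets one follow it inside [B]: in case
    (i) the swap is a relabelling of the loop, in case (ii) it is a swap in [B]. *)

(** [Mod] is given only by its universal property, so what an equality in Mod(C) implies can be read
    off only through a morphism out of it; this is why the classes of presentations are made into a
    modular operad. For B the opposite direction is needed: equivalent presentations must have the
    same value in Mod(B), and this is checked directly for values in any modular operad.

    One vertex suffices because contractions inside a composite may be postponed ([mo_contr_comp]).
    The loops form an unordered set, so the value has to be shown independent of the order of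
    contraction. [mo_contr_swap] is the one axiom that changes which edge between two operations is
    composed and which is contracted; it is the source of the swap move.

    The obstacle is that a swap in C may factor an element of B through [w'] and [w''] lying outside
    B. The property carried along a chain is therefore a predicate on presentations over C,
    recording both that the vertex lies in B and which element of Mod(B) it presents. *)

Lemma id_bij (A : Type) : bijective (@id A).
Proof. by exists id. Qed.

Lemma sig_inj (T : Type) (Q : T -> Prop) (x y : {t : T | Q t}) :
  sval x = sval y -> x = y.
Proof. by case: x y => s p [t q] /= E; apply: eq_exist. Qed.

(** Compositions and contractions commute only with relabellings of the form [omap_bij]; this brings
    a relabelling that fixes the distinguished input into that form. *)
Lemma bij_omapP (A B : Type) (g : option A -> option B) :
  bijective g -> g None = None -> exists2 d, bijective d & g =1 omap d.
Proof.
move=> gb gN; have gi := bij_inj gb; case: (gb) => g' gK g'K.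
have g'N : g' None = None by rewrite -gN gK.
have gS a : {b | g (Some a) = Some b}.
  by case E: (g (Some a)) => [b|]; [exists b | move: E; rewrite -gN => /gi].
have g'S b : {a | g' (Some b) = Some a}.
  case E: (g' (Some b)) => [a|]; first by exists a.
  by move: (g'K (Some b)); rewrite E gN.
exists (fun a => sval (gS a)); last by case=> [a|] //=; case: (gS a).
exists (fun b => sval (g'S b)) => [a|b].
  by case: (g'S _) => a' /=; case: (gS a) => b /= <-; rewrite gK => -[].
by case: (gS _) => b' /=; case: (g'S b) => a /= <-; rewrite g'K => -[].
Qed.

Lemma option_point (T : finType) (t : T) :
  exists (T0 : finType) (e : option T0 -> T), bijective e /\ e None = t.
Proof.
exists {x : T | x != t}, (fun o => if o is Some x then val x else t); split=> //.
exists (fun x : T => insub x) => [[x|]|x] /=.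
- by rewrite valK.
- by rewrite insubN ?eqxx.
- by case: insubP => [u _ <-|/negPn/eqP].
Qed.

(** * Relabelling and associativity in a cyclic operad *)

Section OperadLemmas.
Variable C : cyclic_operad.
Implicit Types S T : finType.

Lemma co_comp_mapl S1 S2 T1 (f : S1 -> T1) (hf : bijective f)
    (x : C (option S1)) (y : C (option S2)) :
  co_comp (co_map (omap_bij hf) x) y =
  co_map (summap_bij hf (id_bij S2)) (co_comp x y).
Proof.
rewrite -co_comp_map; congr co_comp.
by rewrite -[LHS](co_map_id (id_bij _)); apply: co_map_ext; case.
Qed.

Lemma co_comp_mapr S1 S2 T2 (f : S2 -> T2) (hf : bijective f)
    (x : C (option S1)) (y : C (option S2)) :
  co_comp x (co_map (omap_bij hf) y) =
  co_map (summap_bij (id_bij S1) hf) (co_comp x y).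
Proof.
rewrite -co_comp_map; congr co_comp.
by rewrite -[LHS](co_map_id (id_bij _)); apply: co_map_ext; case.
Qed.

Lemma co_map_eqid S (f : S -> S) (hf : bijective f) (x : C S) :
  f =1 id -> co_map hf x = x.
Proof. by move=> fE; rewrite (co_map_ext hf (id_bij S)) // co_map_id. Qed.

Lemma co_mapK S T (f : S -> T) (g : T -> S) (hf : bijective f)
    (hg : bijective g) (x : C S) :
  cancel f g -> co_map hg (co_map hf x) = x.
Proof. by move=> fK; rewrite co_map_comp co_map_eqid. Qed.

Definition sumAC (A B D : Type) (x : (A + B) + D) : (A + D) + B :=
  match x with
  | inl (inl a) => inl (inl a)
  | inl (inr b) => inr b
  | inr d => inl (inr d)
  end.

Lemma sumAC_bij A B D : bijective (@sumAC A B D).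
Proof. by exists (@sumAC A D B) => -[[]|]. Qed.

(** This is [co_compA] with [x] in the middle, turned around by [co_compC]: operations composed with
    two different inputs of [x] may be attached in either order. *)
Lemma co_compAC S1 S2 S3 (x : C (option (option S1)))
    (y : C (option S2)) (z : C (option S3)) :
  co_comp (co_map (outl_bij S1 S2) (co_comp x y)) z =
  co_map (sumAC_bij S1 S3 S2)
    (co_comp (co_map (outl_bij S1 S3) (co_comp (co_map (oswap_bij S1) x) z)) y).
Proof.
have := co_compA y x z; rewrite -[in RHS]co_compC -(co_compC x y).
move=> /(congr1 (co_map (sumC_bij S2 _))); rewrite !co_map_comp.
set u := co_comp (co_map _ (co_comp (co_map _ x) z)) y.
have -> : co_map (bij_comp (outr_bij S2 S1) (sumC_bij (option S1) S2)) (co_comp x y) =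
  co_map (omap_bij (sumC_bij S1 S2)) (co_map (outl_bij S1 S2) (co_comp x y)).
  by rewrite co_map_comp; apply: co_map_ext; repeat case.
rewrite co_comp_mapl co_map_comp.
move=> /(congr1 (co_map (sumAC_bij S1 S3 S2))); rewrite !co_map_comp.
by rewrite co_map_eqid => [->|]; [apply: co_map_ext|]; repeat case.
Qed.
End OperadLemmas.

(** * Bijections of legs and half-edges *)

(** The half-edges must be permuted compatibly with their pairing into loops; [c], which may depend
    on [l], tells whether the loop is flipped. *)
Definition loop_map (S T L L' : Type) (f : S -> T)
    (h : S + L * bool -> T + L' * bool) : Prop :=
  (forall s, h (inl s) = inl (f s)) /\
  (forall l, exists l' c, forall b, h (inr (l, b)) = inr (l', b (+) c)).

Lemma loop_map_comp (S T U L L' L'' : Type) (f : S -> T) (g : T -> U)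
    (h : S + L * bool -> T + L' * bool) (k : T + L' * bool -> U + L'' * bool) :
  loop_map f h -> loop_map g k -> loop_map (g \o f) (k \o h).
Proof.
move=> [hl hr] [kl kr]; split=> [s|l] /=; first by rewrite hl kl.
have [l' [c E]] := hr l; have [l'' [c' E']] := kr l'.
by exists l'', (c (+) c') => b; rewrite /= E E' addbA.
Qed.

Lemma loop_map_inv (S L L' : Type)
    (h : S + L * bool -> S + L' * bool) (k : S + L' * bool -> S + L * bool) :
  cancel h k -> cancel k h -> loop_map id h -> loop_map id k.
Proof.
move=> hK kK [hl hr]; split=> [s|l]; first by rewrite -[RHS]hK hl.
case E: (k (inr (l, false))) => [s|[l1 b1]].
  by have := kK (inr (l, false)); rewrite E hl.
have [l2 [c E2]] := hr l1.
have := kK (inr (l, false)); rewrite E E2 => -[l2E _].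
by exists l1, c => b; rewrite -[RHS]hK E2 -addbA addbb addbF l2E.
Qed.

Definition unit_map (S : Type) (s : S) : S + void * bool := inl s.

Lemma unit_map_bij S : bijective (@unit_map S).
Proof.
exists (fun x : S + void * bool =>
  match x with inl s => s | inr p => match p.1 with end end) => //.
by case=> [s|[[]]].
Qed.

Definition contr_map (S L : Type) (x : option (option S) + L * bool) :
    S + option L * bool :=
  match x with
  | inl None => inr (None, false)
  | inl (Some None) => inr (None, true)
  | inl (Some (Some s)) => inl s
  | inr p => inr (Some p.1, p.2)
  end.

Lemma contr_map_bij S L : bijective (@contr_map S L).
Proof.
exists (fun x : S + option L * bool => match x with
  | inr (None, false) => inl None
  | inr (None, true) => inl (Some None)
  | inl s => inl (Some (Some s))
  | inr (Some l, b) => inr (l, b)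
  end); by [move=> [[[s|]|]|[l b]] | move=> [s|[[l|] []]]].
Qed.

Definition comp_map (S1 S2 L1 L2 : Type) (x : (S1 + L1 * bool) + (S2 + L2 * bool)) :
    (S1 + S2) + (L1 + L2) * bool :=
  match x with
  | inl (inl s) => inl (inl s)
  | inl (inr (l, b)) => inr (inl l, b)
  | inr (inl s) => inl (inr s)
  | inr (inr (l, b)) => inr (inr l, b)
  end.

Lemma comp_map_bij S1 S2 L1 L2 : bijective (@comp_map S1 S2 L1 L2).
Proof.
exists (fun x : (S1 + S2) + (L1 + L2) * bool => match x with
  | inl (inl s) => inl (inl s)
  | inr (inl l, b) => inl (inr (l, b))
  | inl (inr s) => inr (inl s)
  | inr (inr l, b) => inr (inr (l, b))
  end); by [case=> [[s|[l b]]|[s|[l b]]] | case=> [[s|s]|[[l|l] b]]].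
Qed.

(** * Presentations and the two moves *)

Section Reps.
Variable C : cyclic_operad.
Implicit Types R S T L : finType.

(* The half-edges of the loop [l] are [(l, false)] and [(l, true)]. *)
Definition rep S := {L : finType & C (S + L * bool)%type}.
Definition Rep S L (x : C (S + L * bool)%type) : rep S := existT _ L x.
Definition loops S (r : rep S) : finType := projT1 r.
Definition vertex S (r : rep S) : C (S + loops r * bool)%type := projT2 r.

Definition runit S (y : C S) : rep S := Rep (co_map (unit_map_bij S) y).
Definition rmap S T (f : S -> T) (hf : bijective f) (r : rep S) : rep T :=
  Rep (co_map (summap_bij hf (id_bij _)) (vertex r)).
Definition rcontr S (r : rep (option (option S))) : rep S :=
  Rep (co_map (contr_map_bij S (loops r)) (vertex r)).
Definition rcomp S1 S2 (r1 : rep (option S1)) (r2 : rep (option S2)) :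
    rep (S1 + S2)%type :=
  Rep (co_map (comp_map_bij S1 S2 (loops r1) (loops r2))
    (co_comp (co_map (outl_bij S1 _) (vertex r1)) (co_map (outl_bij S2 _) (vertex r2)))).

Definition iso S (r r' : rep S) : Prop :=
  exists (h : S + loops r * bool -> S + loops r' * bool) (hb : bijective h),
    loop_map id h /\ vertex r' = co_map hb (vertex r).

(** Only the two inputs left free by the composition have a prescribed image, the ends of one loop.
    Legs and other loops are spread over [R] and [T] arbitrarily, and other loops may join [w'] to
    [w'']; hence relabelling the legs or contracting two of them merely changes [h]. *)
Definition swap S (r r' : rep S) : Prop :=
  exists (R T L : finType)
    (w' : C (option (option R))) (w'' : C (option (option T)))
    (h : option R + option T -> S + L * bool) (hb : bijective h),
    [/\ exists l c, h (inl None) = inr (l, c) /\ h (inr None) = inr (l, ~~ c),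
      r = Rep (co_map hb (comp_q w' w'')) & r' = Rep (co_map hb (comp_p w' w''))].

Definition step S (r r' : rep S) : Prop := iso r r' \/ swap r r'.
Definition equiv S := clos_refl_sym_trans (rep S) (@step S).

Lemma isoI S L L' (x : C (S + L * bool)%type) (x' : C (S + L' * bool)%type)
    (h : S + L * bool -> S + L' * bool) (hb : bijective h) :
  loop_map id h -> x' = co_map hb x -> iso (Rep x) (Rep x').
Proof. by move=> hl ->; exists h, hb. Qed.

Lemma iso_refl S (r : rep S) : iso r r.
Proof.
exists id, (id_bij _); split; last by rewrite co_map_id.
by split=> // l; exists l, false => b; rewrite addbF.
Qed.

Lemma iso_sym S (r r' : rep S) : iso r r' -> iso r' r.
Proof.
move=> [h [hb [hl E]]]; case: (hb) => k hK kK.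
have kb : bijective k by exists h.
by exists k, kb; split; [exact: loop_map_inv hK kK hl | rewrite E co_mapK].
Qed.

Lemma iso_trans S (r r' r'' : rep S) : iso r r' -> iso r' r'' -> iso r r''.
Proof.
move=> [h [hb [hl E]]] [k [kb [kl E']]].
exists (k \o h), (bij_comp kb hb); split; first exact: loop_map_comp hl kl.
by rewrite E' E co_map_comp.
Qed.

Lemma iso_map S T (f : S -> T) (hf : bijective f) (r r' : rep S) :
  iso r r' -> iso (rmap hf r) (rmap hf r').
Proof.
move=> [h [hb [[hl hr] E]]]; case: (hf) => g fK gK.
have gb : bijective (summap g (@id (loops r * bool))).
  by apply: summap_bij; [exists f | exact: id_bij].
exists (summap f id \o h \o summap g id),
  (bij_comp (bij_comp (summap_bij hf (id_bij _)) hb) gb); split.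
  split=> [s|l] /=; first by rewrite hl /= gK.
  by have [l' [c El]] := hr l; exists l', c => b /=; rewrite El.
rewrite /= E !co_map_comp; apply: co_map_ext => -[s|p] //=.
by rewrite fK.
Qed.

Lemma iso_contr S (r r' : rep (option (option S))) :
  iso r r' -> iso (rcontr r) (rcontr r').
Proof.
move=> [h [hb [[hl hr] E]]].
case: (contr_map_bij S (loops r)) => g fK gK.
have gb : bijective g by exists (@contr_map S (loops r)).
have fb := contr_map_bij S (loops r').
exists (@contr_map S (loops r') \o h \o g), (bij_comp (bij_comp fb hb) gb); split.
  split=> [s|[l|]] /=.
  - by rewrite -[inl s]/(contr_map (inl (Some (Some s)))) fK hl.
  - have [l' [c El]] := hr l; exists (Some l'), c => b.
    by rewrite -[inr _]/(contr_map (inr (l, b))) fK El.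
  - exists None, false => -[].
    + by rewrite -[inr _]/(contr_map (inl (Some None))) fK hl.
    + by rewrite -[inr _]/(contr_map (inl None)) fK hl.
rewrite /= E !co_map_comp; apply: co_map_ext => x /=.
by rewrite fK.
Qed.

Lemma iso_compC S1 S2 (r1 : rep (option S1)) (r2 : rep (option S2)) :
  iso (rmap (sumC_bij S1 S2) (rcomp r1 r2)) (rcomp r2 r1).
Proof.
have hb : bijective (summap (@id (S2 + S1)%type)
    (fun p : (loops r1 + loops r2) * bool => (sumC p.1, p.2))).
  apply: summap_bij; first exact: id_bij.
  by exists (fun p => (sumC p.1, p.2)) => -[[] ?].
apply: (isoI (hb := hb)).
  split=> // -[l|l].
    by exists (inr l), false => b /=; rewrite addbF.
  by exists (inl l), false => b /=; rewrite addbF.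
rewrite -(co_compC (co_map _ (vertex r1))) /= !co_map_comp.
by apply: co_map_ext => -[[s|[l b]]|[s|[l b]]].
Qed.

Lemma iso_compl S1 S2 (r1 r1' : rep (option S1)) (r2 : rep (option S2)) :
  iso r1 r1' -> iso (rcomp r1 r2) (rcomp r1' r2).
Proof.
move=> [h [hb [[hl hr] E]]].
case: (outl_bij S1 (loops r1 * bool)%type) => g fK gK.
have gb : bijective g by exists (@outl S1 (loops r1 * bool)%type).
(* [h] fixes the leg used for the composition, so after [outl] it has the form [omap d], and [d] can
   be pulled out of [co_comp]. *)
have [|d db dE] := bij_omapP (bij_comp (bij_comp (outl_bij _ _) hb) gb).
  by rewrite /= -[None]/(outl (inl None)) fK hl.
case: (comp_map_bij S1 S2 (loops r1) (loops r2)) => k kK k'K.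
have kb : bijective k by exists (@comp_map S1 S2 (loops r1) (loops r2)).
have dl s : d (inl s) = inl s.
  apply: Some_inj; have := dE (Some (inl s)); rewrite /= => <-.
  by rewrite -[Some (inl s)]/(outl (inl (Some s))) fK hl.
have dr l b : Some (d (inr (l, b))) = outl (h (inr (l, b))).
  have := dE (Some (inr (l, b))); rewrite /= => <-.
  by rewrite -[Some (inr _)]/(outl (inr (l, b))) fK.
exists (@comp_map _ _ _ _ \o summap d id \o k),
  (bij_comp (bij_comp (comp_map_bij _ _ _ _) (summap_bij db (id_bij _))) kb).
split; first split.
- move=> [s|s] /=.
    by rewrite -[inl _]/(comp_map (inl (inl s))) kK /= dl.
  by rewrite -[inl _]/(comp_map (inr (inl s))) kK /=.
- move=> [l|l].
    have [l' [c El]] := hr l; exists (inl l'), c => b /=.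
    rewrite -[inr _]/(comp_map (inl (inr (l, b)))) kK /=.
    by have := dr l b; rewrite El => -[->].
  exists (inr l), false => b /=; rewrite addbF.
  by rewrite -[inr _]/(comp_map (inr (inr (l, b)))) kK.
rewrite /= E.
have -> : co_map (outl_bij S1 _) (co_map hb (vertex r1)) =
          co_map (omap_bij db) (co_map (outl_bij S1 _) (vertex r1)).
  rewrite !co_map_comp; apply: co_map_ext => x /=.
  by have := dE (outl x); rewrite /= fK.
rewrite co_comp_mapl !co_map_comp; apply: co_map_ext => x /=.
by rewrite kK.
Qed.

Lemma swap_sym S (r r' : rep S) : swap r r' -> swap r' r.
Proof.
move=> [R [T [L [w' [w'' [h [hb [hl -> ->]]]]]]]].
exists R, T, L, (co_map (oswap_bij R) w'), (co_map (oswap_bij T) w''), h, hb.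
split=> //; rewrite /comp_q !co_mapK //; by move=> [[]|].
Qed.

Lemma co_map_pC R T (U : finType) (w' : C (option (option R)))
    (w'' : C (option (option T))) (h : option R + option T -> U) (hb : bijective h) :
  co_map hb (comp_p w' w'') =
  co_map (bij_comp hb (sumC_bij (option T) (option R))) (comp_p w'' w').
Proof.
by rewrite /comp_p -[in RHS]co_compC co_map_comp; apply: co_map_ext => -[].
Qed.

Lemma co_map_qC R T (U : finType) (w' : C (option (option R)))
    (w'' : C (option (option T))) (h : option R + option T -> U) (hb : bijective h) :
  co_map hb (comp_q w' w'') =
  co_map (bij_comp hb (sumC_bij (option T) (option R))) (comp_q w'' w').
Proof.
by rewrite /comp_q -[in RHS]co_compC co_map_comp; apply: co_map_ext => -[].
Qed.

Lemma iso_equiv S (r r' : rep S) : iso r r' -> equiv r r'.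
Proof. by move=> ?; apply: rst_step; left. Qed.
Lemma swap_equiv S (r r' : rep S) : swap r r' -> equiv r r'.
Proof. by move=> ?; apply: rst_step; right. Qed.

(** * Compatibility of the moves with the operations *)

Lemma equiv_congr S T (F : rep S -> rep T) :
  (forall r r', step r r' -> equiv (F r) (F r')) ->
  forall r r', equiv r r' -> equiv (F r) (F r').
Proof.
move=> FP r r'; elim=> {r r'} [r r'|r|r r' _ ?|r r' r'' _ ? _ ?].
- exact: FP.
- exact: rst_refl.
- exact: rst_sym.
- by apply: rst_trans; eassumption.
Qed.

Lemma equiv_map S T (f : S -> T) (hf : bijective f) (r r' : rep S) :
  equiv r r' -> equiv (rmap hf r) (rmap hf r').
Proof.
apply: equiv_congr => {}r {}r' [/(iso_map hf)/iso_equiv //|].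
move=> [R [U [L [w' [w'' [h [hb [[l [c [hl hr]]] -> ->]]]]]]]].
apply: swap_equiv; exists R, U, L, w', w'', (summap f id \o h).
exists (bij_comp (summap_bij hf (id_bij _)) hb); split.
- by exists l, c; rewrite /= hl hr.
- by rewrite /rmap /= co_map_comp.
- by rewrite /rmap /= co_map_comp.
Qed.

Lemma equiv_contr S (r r' : rep (option (option S))) :
  equiv r r' -> equiv (rcontr r) (rcontr r').
Proof.
apply: equiv_congr => {}r {}r' [/iso_contr/iso_equiv //|].
move=> [R [U [L [w' [w'' [h [hb [[l [c [hl hr]]] -> ->]]]]]]]].
apply: swap_equiv; exists R, U, (option L), w', w'', (@contr_map _ _ \o h).
exists (bij_comp (contr_map_bij _ _) hb); split.
- by exists (Some l), c; rewrite /= hl hr.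
- by rewrite /rcontr /= co_map_comp.
- by rewrite /rcontr /= co_map_comp.
Qed.

Definition ungraft (A Y V : Type) (x : option (A + Y) + V) : (option A + V) + Y :=
  match x with
  | inl None => inl (inl None)
  | inl (Some (inl a)) => inl (inl (Some a))
  | inl (Some (inr y)) => inr y
  | inr v => inl (inr v)
  end.

Lemma ungraft_bij A Y V : bijective (@ungraft A Y V).
Proof.
exists (fun x : (option A + V) + Y => match x with
  | inl (inl None) => inl None
  | inl (inl (Some a)) => inl (Some (inl a))
  | inr y => inl (Some (inr y))
  | inl (inr v) => inr v
  end); by [move=> [[[]|]|] | move=> [[[]|]|]].
Qed.

(* [y] is grafted onto the input [Some (Some None)] of [v]; the inputs [None] and
   [Some None], at which the swap move acts, stay in place. *)
Definition graft R (Y : finType) (v : C (option (option (option R)))) (y : C (option Y)) :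
    C (option (option (R + Y)%type)) :=
  co_map (outll_bij R Y)
    (co_comp (co_map (oswap_bij (option R)) (co_map (omap_bij (oswap_bij R)) v)) y).

(** By [co_compAC], an operation [y] attached to [v] after the composition with [w] may be attached
    before it. The result is again a composite of two operations, the shape on which the swap
    acts. *)
Lemma comp_graft R (V Y : finType) (v : C (option (option (option R)))) (w : C (option V))
    (y : C (option Y)) :
  co_comp (co_map (outl_bij (option R) V)
    (co_map (summap_bij (oswap_bij R) (id_bij V)) (co_comp v w))) y =
  co_map (ungraft_bij R Y V) (co_comp (graft v y) w).
Proof.
have -> : graft v y = co_map (omap_bij (outl_bij R Y)) (co_map (outl_bij (option R) Y)
    (co_comp (co_map (oswap_bij (option R)) (co_map (omap_bij (oswap_bij R)) v)) y)).
  by rewrite /graft !co_map_comp; apply: co_map_ext.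
rewrite co_comp_mapl -(co_comp_mapl (oswap_bij R)) co_compAC !co_map_comp.
by apply: co_map_ext; move=> [[[]|]|].
Qed.

Lemma graft_swap R (Y : finType) (v : C (option (option (option R)))) (y : C (option Y)) :
  co_map (oswap_bij _) (graft v y) = graft (co_map (oswap_bij _) v) y.
Proof.
rewrite /graft.
have -> : co_map (oswap_bij (option R))
    (co_map (omap_bij (oswap_bij R)) (co_map (oswap_bij (option R)) v)) =
    co_map (omap_bij (oswap_bij R)) (co_map (oswap_bij (option R))
      (co_map (omap_bij (oswap_bij R)) v)).
  by rewrite !co_map_comp; apply: co_map_ext; move=> [[[]|]|].
by rewrite co_comp_mapl !co_map_comp; apply: co_map_ext; move=> [[[]|]|].
Qed.

(** The leg used for the composition is an input [t] of [w'] other than p' and q'. So [r2] can be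
    grafted onto [w'], and the same swap takes place between the grafted operation and [w'']. *)
Lemma swap_comp_leg S1 S2 R T L
    (w' : C (option (option R))) (w'' : C (option (option T)))
    (h : option R + option T -> option S1 + L * bool) (hb : bijective h)
    (t : R) (r2 : rep (option S2)) :
  h (inl (Some t)) = inl None ->
  (exists l c, h (inl None) = inr (l, c) /\ h (inr None) = inr (l, ~~ c)) ->
  swap (rcomp (Rep (co_map hb (comp_q w' w''))) r2)
       (rcomp (Rep (co_map hb (comp_p w' w''))) r2).
Proof.
move=> ht [l [c [hl hr]]]; have [R0 [e [eb eN]]] := option_point t.
have [e' eK e'K] := eb.
have e'b : bijective e' by exists e.
(* [v] is [w'] with [t] renamed to [Some (Some None)], the input at which [graft] composes. *)
pose v := co_map (omap_bij (omap_bij e'b)) w'.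
have wE : w' = co_map (omap_bij (omap_bij eb)) v.
  by rewrite co_mapK //; move=> [[x|]|] //=; rewrite e'K.
pose Y : finType := (S2 + loops r2 * bool)%type.
pose y := co_map (outl_bij S2 _) (vertex r2).
pose g : option (option R0) + option T -> option (S1 + L * bool) :=
  @outl _ _ \o h \o summap (omap e) id.
have gb : bijective g.
  exact: bij_comp (bij_comp (outl_bij _ _) hb) (summap_bij (omap_bij eb) (id_bij _)).
case: (outl_bij (option R0) (option T)) => o oK Ko.
have ob : bijective o by exists (@outl (option R0) (option T)).
have [|d db dE] := bij_omapP (bij_comp (bij_comp gb
    (summap_bij (oswap_bij R0) (id_bij (option T)))) ob).
  by have /= -> := oK (inl None); rewrite /g /= eN ht.
have dE' x : omap d (outl x) = g (summap (@oswap R0) id x).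
  by rewrite -dE /= oK.
(* Stated for arbitrary [v1] and [w1] since it is used twice: for [comp_p] with [v] and [w''], and
   for [comp_q] with both of them changed by [oswap]. *)
have main (v1 : C (option (option (option R0)))) (w1 : C (option (option T))) :
  rcomp (Rep (co_map hb (co_comp (co_map (omap_bij (omap_bij eb)) v1) w1))) r2 =
  Rep (co_map (bij_comp (bij_comp (comp_map_bij S1 S2 L (loops r2))
    (summap_bij db (id_bij _))) (ungraft_bij R0 Y (option T)))
    (co_comp (graft v1 y) w1)).
  rewrite /rcomp /=; congr Rep; rewrite -co_map_comp -comp_graft -co_map_comp.
  rewrite -(co_comp_mapl db) -/y; congr (co_map _ (co_comp _ y)).
  rewrite (co_comp_mapl (omap_bij eb)) !co_map_comp; apply: co_map_ext => x /=.
  by rewrite dE' /g /=; case: x => //= -[[]|].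
exists (R0 + Y)%type, T, (L + loops r2)%type, (graft v y), w''.
exists (@comp_map S1 S2 L (loops r2) \o summap d id \o @ungraft R0 Y (option T)).
exists (bij_comp (bij_comp (comp_map_bij S1 S2 L (loops r2))
  (summap_bij db (id_bij _))) (ungraft_bij R0 Y (option T))); split.
- exists (inl l), c => /=; split.
  + have := dE' (inl (Some None)); rewrite /= /g /= hl => -[->] //.
  + have := dE' (inr None); rewrite /= /g /= hr => -[->] //.
- rewrite /comp_q graft_swap -main; congr (rcomp (Rep (co_map hb (co_comp _ _))) r2).
  by rewrite wE /v !co_map_comp; apply: co_map_ext; move=> [[]|].
- by rewrite /comp_p -main -wE.
Qed.

Lemma equiv_compl S1 S2 (r1 r1' : rep (option S1)) (r2 : rep (option S2)) :
  equiv r1 r1' -> equiv (rcomp r1 r2) (rcomp r1' r2).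
Proof.
move: r1 r1'; apply: equiv_congr => r1 r1' [/(iso_compl r2)/iso_equiv //|].
move=> [R [T [L [w' [w'' [h [hb [hl -> ->]]]]]]]]; apply: swap_equiv.
(* The leg used for the composition comes from [w'] or from [w'']. It cannot be a free input of the
   composite, since those go to loop ends; the case of [w''] reduces to that of [w'] by exchanging
   the factors, which reverses the orientation of the loop. *)
case: (hb) => k hK kK; case E: (k (inl None)) => [[t|]|[t|]].
- by apply: (@swap_comp_leg _ _ _ _ _ _ _ _ _ t) => //; rewrite -E kK.
- by case: hl => l [c [+ _]]; rewrite -E kK.
- rewrite co_map_qC co_map_pC.
  apply: (@swap_comp_leg _ _ _ _ _ _ _ _ _ t); first by rewrite /= -E kK.
  by case: hl => l [c [h1 h2]]; exists l, (~~ c); rewrite /= h1 h2 negbK.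
- by case: hl => l [c [_]]; rewrite -E kK.
Qed.

Lemma equiv_comp S1 S2 (r1 r1' : rep (option S1)) (r2 r2' : rep (option S2)) :
  equiv r1 r1' -> equiv r2 r2' -> equiv (rcomp r1 r2) (rcomp r1' r2').
Proof.
move=> /(equiv_compl r2) E1 /(equiv_compl r1') /(equiv_map (sumC_bij _ _)) E2.
apply: rst_trans E1 _; apply: rst_trans (rst_sym _ _ _ _ (iso_equiv (iso_compC _ _))) _.
exact: rst_trans E2 (iso_equiv (iso_compC _ _)).
Qed.

(** * The modular operad axioms up to the moves *)

Lemma iso_relabel S L L' (x : C (S + L * bool)%type) (x' : C (S + L' * bool)%type)
    (f : L -> L') (h : S + L * bool -> S + L' * bool) (hb : bijective h) :
  h =1 summap id (fun p => (f p.1, p.2)) -> x' = co_map hb x -> iso (Rep x) (Rep x').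
Proof.
move=> hE; apply: isoI; split=> [s|l]; first by rewrite hE.
by exists (f l), false => b; rewrite hE /= addbF.
Qed.

Lemma relabel_bij (S L L' : Type) (f : L -> L') : bijective f ->
  bijective (summap (@id S) (fun p : L * bool => (f p.1, p.2))).
Proof.
move=> [g fK gK]; apply: summap_bij; first exact: id_bij.
by exists (fun p => (g p.1, p.2)) => -[l b] /=; rewrite ?fK ?gK.
Qed.

Lemma rmap_ext S T (f g : S -> T) (hf : bijective f) (hg : bijective g) (r : rep S) :
  f =1 g -> rmap hf r = rmap hg r.
Proof.
by move=> fg; congr Rep; apply: co_map_ext => -[s|p] //=; rewrite fg.
Qed.

Lemma rmap_id S (h : bijective (@id S)) (r : rep S) : rmap h r = r.
Proof.
case: r => L x; rewrite /rmap /=; congr existT.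
by apply: co_map_eqid => -[].
Qed.

Lemma rmap_comp S T R (f : S -> T) (g : T -> R) (hf : bijective f)
    (hg : bijective g) (r : rep S) :
  rmap hg (rmap hf r) = rmap (bij_comp hg hf) r.
Proof. by rewrite /rmap /=; congr Rep; rewrite co_map_comp; apply: co_map_ext => -[]. Qed.

Lemma rcomp_map S1 S2 T1 T2 (f : S1 -> T1) (g : S2 -> T2)
    (hf : bijective f) (hg : bijective g)
    (r1 : rep (option S1)) (r2 : rep (option S2)) :
  rcomp (rmap (omap_bij hf) r1) (rmap (omap_bij hg) r2) =
  rmap (summap_bij hf hg) (rcomp r1 r2).
Proof.
rewrite /rcomp /rmap /=; congr Rep.
have E T1' T2' L (k : T1' -> T2') (hk : bijective k) (x : C (option T1' + L * bool)%type) :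
    co_map (outl_bij _ _) (co_map (summap_bij (omap_bij hk) (id_bij _)) x) =
    co_map (omap_bij (summap_bij hk (id_bij _))) (co_map (outl_bij _ _) x).
  by rewrite !co_map_comp; apply: co_map_ext => -[[]|].
by rewrite !E co_comp_map !co_map_comp; apply: co_map_ext => -[[s|[l b]]|[s|[l b]]].
Qed.

Lemma iso_compA S1 S2 S3 (r1 : rep (option S1)) (r2 : rep (option (option S2)))
    (r3 : rep (option S3)) :
  iso (rmap (sumA_bij S1 S2 S3) (rcomp (rmap (outr_bij S1 S2) (rcomp r1 r2)) r3))
      (rcomp r1 (rmap (outl_bij S2 S3) (rcomp (rmap (oswap_bij S2) r2) r3))).
Proof.
apply: (iso_relabel (f := @sumA _ _ _)
  (hb := relabel_bij _ (sumA_bij (loops r1) (loops r2) (loops r3)))) => //=.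
set X := co_map _ (vertex r1); set Z := co_map _ (vertex r3).
pose Y := co_map (omap_bij (outl_bij S2 _)) (co_map (outl_bij _ _) (vertex r2)).
have -> : co_map (outl_bij _ _)
    (co_map (summap_bij (outr_bij S1 S2) (id_bij _)) (co_map (comp_map_bij _ _ _ _)
      (co_comp X (co_map (outl_bij _ _) (vertex r2))))) =
    co_map (omap_bij (comp_map_bij _ _ _ _)) (co_map (outr_bij _ _) (co_comp X Y)).
  rewrite /Y co_comp_mapr !co_map_comp; apply: co_map_ext.
  by move=> [[s|[l b]]|[[s|]|[l b]]].
have -> : co_map (outl_bij _ _)
    (co_map (summap_bij (outl_bij S2 S3) (id_bij _)) (co_map (comp_map_bij _ _ _ _)
      (co_comp (co_map (outl_bij _ _)
        (co_map (summap_bij (oswap_bij S2) (id_bij _)) (vertex r2))) Z))) =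
    co_map (omap_bij (comp_map_bij _ _ _ _)) (co_map (outl_bij _ _)
      (co_comp (co_map (oswap_bij _) Y) Z)).
  have -> : co_map (oswap_bij _) Y = co_map (omap_bij (outl_bij S2 _))
      (co_map (outl_bij _ _) (co_map (summap_bij (oswap_bij S2) (id_bij _)) (vertex r2))).
    by rewrite /Y !co_map_comp; apply: co_map_ext => -[[[s|]|]|[l b]].
  rewrite co_comp_mapl !co_map_comp; apply: co_map_ext.
  by move=> [[[s|]|[l b]]|[s|[l b]]].
rewrite co_comp_mapl co_comp_mapr -co_compA !co_map_comp; apply: co_map_ext.
by move=> [[[s|[l b]]|[s|[l b]]]|[s|[l b]]].
Qed.

Lemma rcontr_map S T (f : S -> T) (hf : bijective f) (r : rep (option (option S))) :
  rcontr (rmap (omap_bij (omap_bij hf)) r) = rmap hf (rcontr r).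
Proof.
rewrite /rcontr /rmap /=; congr Rep; rewrite !co_map_comp.
by apply: co_map_ext => -[[[s|]|]|[l b]].
Qed.

Lemma iso_contr_sym S (r : rep (option (option S))) :
  iso (rcontr (rmap (oswap_bij S) r)) (rcontr r).
Proof.
(* [~~ p.1] holds exactly when [p.1] is the new loop [None], so [k] flips this loop and no other. *)
pose k (p : option (loops r) * bool) := (p.1, p.2 (+) ~~ p.1).
have kK : involutive k by move=> [[l|] []].
have hb : bijective (summap (@id S) k).
  by apply: summap_bij; [exact: id_bij | exists k].
apply: (isoI (hb := hb)).
  split=> // l; exists l, (~~ l) => b //.
by rewrite /= !co_map_comp; apply: co_map_ext => -[[[s|]|]|[l b]] //=; rewrite /k /= addbF.
Qed.

Lemma iso_contrC S (r : rep (option (option (option (option S))))) :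
  iso (rcontr (rcontr (rmap (opairswap_bij S) r))) (rcontr (rcontr r)).
Proof.
apply: (iso_relabel (hb := relabel_bij _ (oswap_bij (loops r)))) => //=.
by rewrite !co_map_comp; apply: co_map_ext => -[[[[[s|]|]|]|]|[l b]].
Qed.

Definition assoc_label (L1 L2 : Type) (x : option (L1 + L2)) : option L1 + L2 :=
  match x with
  | None => inl None
  | Some (inl l) => inl (Some l)
  | Some (inr l) => inr l
  end.

Lemma assoc_label_bij L1 L2 : bijective (@assoc_label L1 L2).
Proof.
exists (fun x : option L1 + L2 => match x with
  | inl None => None
  | inl (Some l) => Some (inl l)
  | inr l => Some (inr l)
  end); by [move=> [[]|] | move=> [[]|]].
Qed.

Lemma iso_contr_comp S1 S2 (r1 : rep (option (option (option S1))))
    (r2 : rep (option S2)) :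
  iso (rcontr (rmap (outll_bij S1 S2) (rcomp r1 r2)))
      (rcomp (rcontr (rmap (orot_bij S1) r1)) r2).
Proof.
apply: (iso_relabel (hb := relabel_bij _ (assoc_label_bij (loops r1) (loops r2)))) => //=.
have -> : co_map (outl_bij _ _) (co_map (contr_map_bij _ _)
      (co_map (summap_bij (orot_bij S1) (id_bij _)) (vertex r1))) =
    co_map (omap_bij (contr_map_bij _ _)) (co_map (outl_bij _ _) (vertex r1)).
  by rewrite !co_map_comp; apply: co_map_ext => -[[[[s|]|]|]|[l b]].
rewrite co_comp_mapl !co_map_comp; apply: co_map_ext.
by move=> [[[[s|]|]|[l b]]|[s|[l b]]].
Qed.

(** The only axiom for which the swap move is used; the others hold on presentations up to [iso].
    The loops of [r1] and [r2] count as ordinary further inputs of the factors [w'] and [w'']. *)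
Lemma swap_contr_comp S1 S2 (r1 : rep (option (option S1)))
    (r2 : rep (option (option S2))) :
  swap (rcontr (rmap (outlr_bij S1 S2) (rcomp r1 r2)))
    (rcontr (rmap (outlr_bij S1 S2)
      (rcomp (rmap (oswap_bij S1) r1) (rmap (oswap_bij S2) r2)))).
Proof.
case: (outl_bij S1 (loops r1 * bool)) => o1 oK1 Ko1.
case: (outl_bij S2 (loops r2 * bool)) => o2 oK2 Ko2.
have ob1 : bijective o1 by exists (@outl _ _).
have ob2 : bijective o2 by exists (@outl _ _).
pose W S (r : rep (option (option S))) :=
  co_map (omap_bij (outl_bij S _)) (co_map (outl_bij _ _) (vertex r)).
apply: swap_sym.
exists (S1 + loops r1 * bool)%type, (S2 + loops r2 * bool)%type,
  (option (loops r1 + loops r2)), (W _ r1), (W _ r2).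
exists (@contr_map _ _ \o summap (fun x => omap (@outr S1 S2) (outl x)) id
  \o @comp_map _ _ _ _ \o summap o1 o2).
exists (bij_comp (bij_comp (bij_comp (contr_map_bij _ _)
  (summap_bij (outlr_bij S1 S2) (id_bij _))) (comp_map_bij _ _ _ _)) (summap_bij ob1 ob2)).
split.
- exists None, false => /=.
  by rewrite -[None]/(outl (inl None)) oK1 -[X in o2 X]/(outl (inl None)) oK2.
- have WE S (r : rep (option (option S))) : co_map (oswap_bij _) (W S r) =
      co_map (omap_bij (outl_bij S _)) (co_map (outl_bij _ _)
        (co_map (summap_bij (oswap_bij _) (id_bij _)) (vertex r))).
    by rewrite /W !co_map_comp; apply: co_map_ext => -[[[s|]|]|].
  rewrite /rcontr /=; congr Rep; rewrite /comp_q !WE co_comp_map !co_map_comp.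
  by apply: co_map_ext => -[x|x] /=; rewrite ?oK1 ?oK2.
- rewrite /rcontr /=; congr Rep; rewrite /comp_p /W co_comp_map !co_map_comp.
  by apply: co_map_ext => -[x|x] /=; rewrite ?oK1 ?oK2.
Qed.

Lemma runit_map S T (f : S -> T) (hf : bijective f) (y : C S) :
  runit (co_map hf y) = rmap hf (runit y).
Proof. by rewrite /rmap /runit /=; congr Rep; rewrite !co_map_comp; apply: co_map_ext. Qed.

Lemma iso_unit_comp S1 S2 (x : C (option S1)) (y : C (option S2)) :
  iso (runit (co_comp x y)) (rcomp (runit x) (runit y)).
Proof.
pose f (p : void * bool) : (void + void) * bool := (inl p.1, p.2).
have hb : bijective (summap (@id (S1 + S2)%type) f).
  apply: summap_bij; first exact: id_bij.
  by exists (fun p => match p.1 with inl v | inr v => (v, p.2) end) => [[[]]|[[[]|[]]]].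
apply: (isoI (hb := hb)); first by split=> // -[].
have E S (z : C (option S)) : co_map (outl_bij _ _) (vertex (runit z)) =
    co_map (omap_bij (unit_map_bij _)) z.
  by rewrite !co_map_comp; apply: co_map_ext => -[].
by rewrite !E co_comp_map !co_map_comp; apply: co_map_ext => -[].
Qed.
End Reps.

(** * The modular operad of classes of presentations *)

Section LoopOperad.
Variables (half : bool) (C : cyclic_operad).
Implicit Types S T : finType.

Definition rgen S (r : rep C S) : nat := #|loops r| * genus_one half.

(** The quotient by [equiv], with a class encoded as the predicate [equiv r]; the genus is read off
    from a representative. *)
Definition loop_class S (G : nat) : Type :=
  {P : rep C S -> Prop | exists2 r, rgen r = G & P = equiv r}.

Lemma equiv_eqP S (r r' : rep C S) : equiv r = equiv r' <-> equiv r r'.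
Proof.
split=> [->|rr']; first exact: rst_refl.
apply: funext => s; apply: propext; split; apply: rst_trans => //.
exact: rst_sym.
Qed.

(** The saturated image of a class, defined without choosing a representative. *)
Definition lift1 S T (F : rep C S -> rep C T) (P : rep C S -> Prop) (t : rep C T) :=
  exists2 r, P r & equiv (F r) t.

Definition lift2 S S' T (F : rep C S -> rep C S' -> rep C T)
    (P : rep C S -> Prop) (Q : rep C S' -> Prop) (t : rep C T) :=
  exists r r', [/\ P r, Q r' & equiv (F r r') t].

Lemma lift1E S T (F : rep C S -> rep C T) (r : rep C S) :
  (forall r r', equiv r r' -> equiv (F r) (F r')) -> lift1 F (equiv r) = equiv (F r).
Proof.
move=> FP; apply: funext => t; apply: propext; split; last first.
  by exists r => //; exact: rst_refl.
by move=> [r' /FP]; exact: rst_trans.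
Qed.

Lemma lift2E S S' T (F : rep C S -> rep C S' -> rep C T) (r : rep C S) (r' : rep C S') :
  (forall r1 r1' r2 r2', equiv r1 r1' -> equiv r2 r2' -> equiv (F r1 r2) (F r1' r2')) ->
  lift2 F (equiv r) (equiv r') = equiv (F r r').
Proof.
move=> FP; apply: funext => t; apply: propext; split; last first.
  by exists r, r'; split=> //; exact: rst_refl.
by move=> [s [s' [rs rs']]]; apply: rst_trans; exact: FP.
Qed.

Definition lmap S T G (f : S -> T) (hf : bijective f) (x : loop_class S G) :
  loop_class T G.
Proof.
exists (lift1 (rmap hf) (sval x)); case: (svalP x) => r rG ->.
by exists (rmap hf r) => //; rewrite lift1E //; exact: equiv_map.
Defined.

Definition lcomp S1 S2 G1 G2 (x : loop_class (option S1) G1)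
    (y : loop_class (option S2) G2) : loop_class (S1 + S2)%type (G1 + G2).
Proof.
exists (lift2 (@rcomp _ _ _) (sval x) (sval y)).
case: (svalP x) => r rG ->; case: (svalP y) => r' rG' ->.
exists (rcomp r r'); first by rewrite -rG -rG' -mulnDl -card_sum.
by rewrite lift2E //; exact: equiv_comp.
Defined.

Definition lcontr S G (x : loop_class (option (option S)) G) :
  loop_class S (G + genus_one half).
Proof.
exists (lift1 (@rcontr _ _) (sval x)); case: (svalP x) => r rG ->.
exists (rcontr r); last by rewrite lift1E //; exact: equiv_contr.
by rewrite -rG /rgen /rcontr /loops /= card_option mulSn addnC.
Defined.

Lemma sval_ecast S G G' (e : G = G') (x : loop_class S G) :
  sval (ecast G (loop_class S G) e x) = sval x.
Proof. by case: _ / e. Qed.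

Lemma loop_classP S G (x : loop_class S G) : exists r, sval x = equiv r.
Proof. by case: (svalP x) => r _ ->; exists r. Qed.

Lemma sval_lmap S T G (f : S -> T) (hf : bijective f) (x : loop_class S G) r :
  sval x = equiv r -> sval (lmap hf x) = equiv (rmap hf r).
Proof. by move=> /= ->; rewrite lift1E //; exact: equiv_map. Qed.

Lemma sval_lcomp S1 S2 G1 G2 (x : loop_class (option S1) G1)
    (y : loop_class (option S2) G2) r r' :
  sval x = equiv r -> sval y = equiv r' -> sval (lcomp x y) = equiv (rcomp r r').
Proof. by move=> /= -> ->; rewrite lift2E //; exact: equiv_comp. Qed.

Lemma sval_lcontr S G (x : loop_class (option (option S)) G) r :
  sval x = equiv r -> sval (lcontr x) = equiv (rcontr r).
Proof. by move=> /= ->; rewrite lift1E //; exact: equiv_contr. Qed.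

Definition loop_operad : modular_operad half.
Proof.
refine (@ModularOperad half loop_class lmap lcomp lcontr _ _ _ _ _ _ _ _ _ _ _).
- move=> S T G f g hf hg x fg; apply: sig_inj.
  have [r xr] := loop_classP x; rewrite !(sval_lmap _ xr).
  by rewrite (rmap_ext hf hg).
- move=> S G h x; apply: sig_inj.
  by have [r xr] := loop_classP x; rewrite (sval_lmap _ xr) rmap_id.
- move=> S T U G f g hf hg x; apply: sig_inj.
  have [r xr] := loop_classP x; rewrite (sval_lmap _ xr).
  by rewrite (sval_lmap _ (sval_lmap _ xr)) rmap_comp.
- move=> S1 S2 T1 T2 G1 G2 f g hf hg x y; apply: sig_inj.
  have [r xr] := loop_classP x; have [s ys] := loop_classP y.
  rewrite (sval_lcomp (sval_lmap _ xr) (sval_lmap _ ys)).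
  by rewrite (sval_lmap _ (sval_lcomp xr ys)) rcomp_map.
- move=> S1 S2 G1 G2 x y; apply: sig_inj; rewrite sval_ecast.
  have [r xr] := loop_classP x; have [s ys] := loop_classP y.
  rewrite (sval_lcomp ys xr) (sval_lmap _ (sval_lcomp xr ys)).
  by apply/equiv_eqP/iso_equiv/iso_compC.
- move=> S1 S2 S3 G1 G2 G3 x y z; apply: sig_inj; rewrite sval_ecast.
  have [r xr] := loop_classP x; have [s ys] := loop_classP y.
  have [t zt] := loop_classP z.
  rewrite (sval_lmap _ (sval_lcomp (sval_lmap _ (sval_lcomp xr ys)) zt)).
  rewrite (sval_lcomp xr (sval_lmap _ (sval_lcomp (sval_lmap _ ys) zt))).
  by apply/equiv_eqP/iso_equiv/iso_compA.
- move=> S T G f hf x; apply: sig_inj; have [r xr] := loop_classP x.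
  rewrite (sval_lcontr (sval_lmap _ xr)) (sval_lmap _ (sval_lcontr xr)).
  by rewrite rcontr_map.
- move=> S G x; apply: sig_inj; have [r xr] := loop_classP x.
  rewrite (sval_lcontr (sval_lmap _ xr)) (sval_lcontr xr).
  by apply/equiv_eqP/iso_equiv/iso_contr_sym.
- move=> S G x; apply: sig_inj; have [r xr] := loop_classP x.
  rewrite (sval_lcontr (sval_lcontr (sval_lmap _ xr))) (sval_lcontr (sval_lcontr xr)).
  by apply/equiv_eqP/iso_equiv/iso_contrC.
- move=> S1 S2 G1 G2 x y; apply: sig_inj; rewrite sval_ecast.
  have [r xr] := loop_classP x; have [s ys] := loop_classP y.
  rewrite (sval_lcontr (sval_lmap _ (sval_lcomp xr ys))).
  rewrite (sval_lcomp (sval_lcontr (sval_lmap _ xr)) ys).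
  by apply/equiv_eqP/iso_equiv/iso_contr_comp.
- move=> S1 S2 G1 G2 x y; apply: sig_inj.
  have [r xr] := loop_classP x; have [s ys] := loop_classP y.
  rewrite (sval_lcontr (sval_lmap _ (sval_lcomp xr ys))).
  rewrite (sval_lcontr (sval_lmap _ (sval_lcomp (sval_lmap _ xr) (sval_lmap _ ys)))).
  by apply/equiv_eqP/swap_equiv/swap_contr_comp.
Defined.

Lemma rgen_unit S (y : C S) : rgen (runit y) = 0.
Proof. by rewrite /rgen /loops /= card_void. Qed.

Definition loop_unit : cyclic_hom C (genus0 loop_operad).
Proof.
refine (@CyclicHom C (genus0 loop_operad)
  (fun S y => exist _ (equiv (runit y)) (ex_intro2 _ _ _ (rgen_unit y) erefl)) _ _).
- move=> S T f hf y; apply: sig_inj => /=.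
  by rewrite lift1E ?runit_map //; exact: equiv_map.
- move=> S1 S2 x y; apply: sig_inj => /=; rewrite lift2E; last exact: equiv_comp.
  by apply/equiv_eqP/iso_equiv/iso_unit_comp.
Defined.
End LoopOperad.

(* [k] undoes a contraction: up to relabelling of loops it is [contr_map], and
   the two half-edges [None], [Some None] become the loop [l] with orientation [c]. *)
Definition opens (S L0 L : Type) (k : option (option S) + L0 * bool -> S + L * bool)
    (l : L) (c : bool) : Prop :=
  [/\ forall s, k (inl (Some (Some s))) = inl s,
      k (inl None) = inr (l, c), k (inl (Some None)) = inr (l, ~~ c) &
      forall l0, exists l' c', forall b, k (inr (l0, b)) = inr (l', b (+) c')].

Lemma opens_comp (S L1 L0 L : Type) (k : option (option S) + L0 * bool -> S + L * bool)
    (h : option (option S) + L1 * bool -> option (option S) + L0 * bool) l c :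
  opens k l c -> loop_map id h -> opens (k \o h) l c.
Proof.
move=> [k1 k2 k3 k4] [h1 h2]; split=> [s|||l0] /=; rewrite ?h1 //.
have [l' [c' E]] := h2 l0; have [l2 [c2 E']] := k4 l'.
by exists l2, (c' (+) c2) => b; rewrite E E' addbA.
Qed.

Lemma opens_loop (S L0 L : Type) (k : option (option S) + L0 * bool -> S + L * bool)
    (l l' : L) c c' :
  bijective k -> opens k l c -> l <> l' ->
  exists l0 c0, forall b, k (inr (l0, b (+) c0)) = inr (l', b (+) c').
Proof.
move=> [g gK Kg] [k1 k2 k3 k4] ll'.
case E: (g (inr (l', c'))) => [[[s|]|]|[l0 b0]]; have := Kg (inr (l', c')); rewrite E.
- by rewrite k1.
- by rewrite k3 => -[/ll'].
- by rewrite k2 => -[/ll'].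
have [l2 [c2 E2]] := k4 l0; rewrite E2 => -[l2E bc].
by exists l0, b0 => b; rewrite E2 -addbA bc l2E.
Qed.

Lemma opens_ex (S L : finType) (l : L) (c : bool) :
  exists (L0 : finType) (k : option (option S) + L0 * bool -> S + L * bool),
    bijective k /\ opens k l c.
Proof.
have [L0 [e [[e' eK e'K] eN]]] := option_point l.
(* [contr_map] sends [None] to the end [false] of the new loop; [u] flips that loop alone when the
   prescribed end [c] is [true]. *)
pose u (x : option L0) := c && ~~ x.
exists L0, (summap id (fun p => (e p.1, p.2 (+) u p.1)) \o @contr_map S L0); split.
  apply: bij_comp (contr_map_bij S L0); apply: summap_bij; first by exists id.
  exists (fun p => (e' p.1, p.2 (+) u (e' p.1))) => -[x b] /=.
    by rewrite eK -addbA addbb addbF.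
  by rewrite e'K -addbA addbb addbF.
split=> //=; rewrite ?eN /u /= ?andbT //.
by move=> l0; exists (e (Some l0)), false => b; rewrite andbF.
Qed.

(** * Comparing the ways to cut loops open *)

Section Opening.
Variables (C : cyclic_operad).
Implicit Types S T L : finType.

(** With its converse [opens_iso], this replaces an isomorphism with a contraction by a bijection
    showing which loop of [r] was contracted, and in which orientation. *)
Lemma iso_opens S (r0 : rep C (option (option S))) (r : rep C S)
    (k : option (option S) + loops r0 * bool -> S + loops r * bool) (kb : bijective k) l c :
  opens k l c -> vertex r = co_map kb (vertex r0) -> iso (rcontr r0) r.
Proof.
move=> [k1 k2 k3 k4] E; case: (contr_map_bij S (loops r0)) => g gK Kg.
have gb : bijective g by exists (@contr_map S (loops r0)).
exists (k \o g), (bij_comp kb gb); split; first split.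
- by move=> s /=; rewrite -[inl s]/(contr_map (inl (Some (Some s)))) gK k1.
- move=> [l0|] /=.
    have [l' [c' El]] := k4 l0; exists l', c' => b.
    by rewrite -[inr _]/(contr_map (inr (l0, b))) gK El.
  exists l, c => -[].
    by rewrite -[inr _]/(contr_map (inl (Some None))) gK k3.
  by rewrite -[inr _]/(contr_map (inl None)) gK k2.
by rewrite E /= co_map_comp; apply: co_map_ext => x /=; rewrite gK.
Qed.

Lemma opens_iso S (r0 : rep C (option (option S))) (r : rep C S) :
  iso (rcontr r0) r ->
  exists (k : option (option S) + loops r0 * bool -> S + loops r * bool) (kb : bijective k) l c,
    opens k l c /\ vertex r = co_map kb (vertex r0).
Proof.
move=> [h [hb [[h1 h2] E]]]; have [l [c El]] := h2 None.
exists (h \o @contr_map _ _), (bij_comp hb (contr_map_bij _ _)), l, c.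
split; last by rewrite E /= co_map_comp.
by split=> [s|||l0] /=; rewrite ?h1 ?El.
Qed.

Lemma rep_opens S (r : rep C S) (l : loops r) c :
  exists (r0 : rep C (option (option S)))
    (k : option (option S) + loops r0 * bool -> S + loops r * bool) (kb : bijective k),
    opens k l c /\ vertex r = co_map kb (vertex r0).
Proof.
have [L0 [k [kb kl]]] := opens_ex S l c; case: (kb) => g gK Kg.
have gb : bijective g by exists k.
exists (Rep (co_map gb (vertex r))), k, kb; split=> //=.
by rewrite co_mapK.
Qed.

Lemma iso_card S (r r' : rep C S) : iso r r' -> #|loops r| = #|loops r'|.
Proof.
move=> [h [hb _]]; have := bij_eq_card hb.
rewrite !card_sum !card_prod card_bool => /addnI/eqP.
by rewrite eqn_pmul2r // => /eqP.
Qed.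

Lemma iso_unit_inj S (y y' : C S) : iso (runit y) (runit y') -> y = y'.
Proof.
move=> [h [hb [[h1 _] /= E]]]; case: (unit_map_bij S) => g gK Kg.
have gb : bijective g by exists (@unit_map S).
rewrite -(co_mapK (unit_map_bij S) gb y' gK) E.
rewrite -[LHS](co_mapK (unit_map_bij S) gb y gK) !co_map_comp.
by apply: co_map_ext => s /=; rewrite h1.
Qed.

Lemma iso_unit_ex S (r : rep C S) : #|loops r| = 0 -> exists y, iso (runit y) r.
Proof.
move=> /card0_eq L0; have no (l : loops r) : False by have := L0 l; rewrite inE.
pose i (s : S) : S + loops r * bool := inl s.
pose j (x : S + loops r * bool) : S :=
  match x with inl s => s | inr p => False_rect _ (no p.1) end.
have iK : cancel i j by [].
have jK : cancel j i by move=> [s|[l b]] //; case: (no l).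
have ib : bijective i by exists j.
have jb : bijective j by exists i.
case: (unit_map_bij S) => g gK Kg.
have gb : bijective g by exists (@unit_map S).
exists (co_map jb (vertex r)), (i \o g), (bij_comp ib gb); split; first split.
- by move=> s /=; rewrite -[inl s]/(unit_map s) gK.
- by case.
- by rewrite /= !co_map_comp co_map_eqid // => x /=; rewrite gK jK.
Qed.

Lemma oswapK (A : Type) : involutive (@oswap A).
Proof. by move=> [[]|]. Qed.

Lemma opairswapK (A : Type) : involutive (@opairswap A).
Proof. by move=> [[[[]|]|]|]. Qed.

(** [k1] followed by the inverse of [k2] preserves the remaining loops. It fixes the two new inputs
    if [c1 = c2] and exchanges them otherwise. *)
Lemma opens_same S (r1 r2 : rep C (option (option S))) (r : rep C S)
    (k1 : option (option S) + loops r1 * bool -> S + loops r * bool) (kb1 : bijective k1)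
    (k2 : option (option S) + loops r2 * bool -> S + loops r * bool) (kb2 : bijective k2)
    l c1 c2 :
  opens k1 l c1 -> opens k2 l c2 ->
  vertex r = co_map kb1 (vertex r1) -> vertex r = co_map kb2 (vertex r2) ->
  iso r1 r2 \/ iso (rmap (oswap_bij S) r1) r2.
Proof.
move=> [k11 k12 k13 k14] o2 E1 E2; have [k21 k22 k23 k24] := o2.
case: (kb2) => g gK Kg; have gb : bijective g by exists k2.
have E : vertex r2 = co_map gb (co_map kb1 (vertex r1)) by rewrite -E1 E2 co_mapK.
have loop l0 : exists l' c', forall b, g (k1 (inr (l0, b))) = inr (l', b (+) c').
  have [l1 [d1 El1]] := k14 l0.
  have ll1 : l <> l1.
    move=> ll1; have := El1 (c1 (+) d1); rewrite -addbA addbb addbF -ll1 -k12.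
    by move/(bij_inj kb1).
  have [l2 [d2 El2]] := opens_loop d1 kb2 o2 ll1.
  by exists l2, d2 => b; rewrite El1 -El2 gK.
have [c12|c12] := eqVneq c1 c2.
  left; exists (g \o k1), (bij_comp gb kb1); split; last by rewrite E co_map_comp.
  split=> // -[[s|]|] /=.
  - by rewrite k11 -k21 gK.
  - by rewrite k13 c12 -k23 gK.
  - by rewrite k12 c12 -k22 gK.
right.
exists (g \o k1 \o summap (@oswap S) id).
exists (bij_comp (bij_comp gb kb1) (summap_bij (oswap_bij S) (id_bij _))); split.
  have c2E : c2 = ~~ c1 by case: c1 c2 c12 {k12 k13 o2 k22 k23} => -[].
  split=> // -[[s|]|] /=.
  - by rewrite k11 -k21 gK.
  - by rewrite k12 -[c1]negbK -c2E -k23 gK.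
  - by rewrite k13 -c2E -k22 gK.
rewrite E /= !co_map_comp; apply: co_map_ext => -[x|x] //=.
by rewrite oswapK.
Qed.

(** [r12] has both loops cut open: it is [r2] with the loop over [l1] opened too. Its first two
    inputs are the ends of [l1], the next two those of [l2], so [opairswap] decides which loop is
    closed. *)
Lemma opens_diff S (r1 r2 : rep C (option (option S))) (r : rep C S)
    (k1 : option (option S) + loops r1 * bool -> S + loops r * bool) (kb1 : bijective k1)
    (k2 : option (option S) + loops r2 * bool -> S + loops r * bool) (kb2 : bijective k2)
    l1 l2 c1 c2 :
  opens k1 l1 c1 -> opens k2 l2 c2 -> l1 <> l2 ->
  vertex r = co_map kb1 (vertex r1) -> vertex r = co_map kb2 (vertex r2) ->
  exists r12, iso (rcontr (rmap (opairswap_bij S) r12)) r1 /\ iso (rcontr r12) r2.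
Proof.
move=> o1 o2 l12 E1 E2; have [k11 k12 k13 k14] := o1.
have [k21 k22 k23 k24] := o2.
case: (kb1) => g gK Kg; have gb : bijective g by exists k1.
have [l0 [c0 El0]] := opens_loop c1 kb2 o2 (fun e => l12 (esym e)).
have [r12 [k [kb [kl E12]]]] := @rep_opens _ r2 l0 c0.
exists r12; split; last exact: iso_opens kl E12.
have [l3 [c3 El3]] := opens_loop c2 kb1 o1 l12.
have [h1 h2 h3 h4] := kl.
apply: (@iso_opens _ (rmap (opairswap_bij S) r12) _ (g \o k2 \o k \o summap (@opairswap S) id)
  (bij_comp (bij_comp (bij_comp gb kb2) kb) (summap_bij (opairswap_bij S) (id_bij _))) l3 c3).
  split=> /=.
  - move=> [[s|]|] /=.
    + by rewrite h1 k21 -k11 gK.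
    + by rewrite h3 -[~~ c0]/(true (+) c0) El0 /= -k13 gK.
    + by rewrite h2 -[c0]/(false (+) c0) El0 /= -k12 gK.
  - by rewrite h1 k22 -[c2]/(false (+) c2) -El3 gK.
  - by rewrite h1 k23 -[~~ c2]/(true (+) c2) -El3 gK.
  move=> l; have [l' [c' El]] := h4 l.
  have [l4 [c4 El4]] := k24 l'; rewrite /=.
  have l14 : l1 <> l4.
    (* This end of [l] is chosen so as to land on the end [c1] of [l1], which is already the image
       of the input [None]. *)
    move=> l14; have : k2 (k (inr (l, c1 (+) c4 (+) c'))) = k2 (k (inl None)).
      rewrite El El4 h2 -[c0]/(false (+) c0) El0 /= l14.
      by rewrite -[_ (+) c' (+) c']addbA addbb addbF -addbA addbb addbF.
    by move/(bij_inj kb2)/(bij_inj kb).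
  have [l5 [c5 El5]] := opens_loop (c' (+) c4) kb1 o1 l14.
  by exists l5, c5 => b; rewrite El El4 -addbA -El5 gK.
rewrite /= !co_map_comp.
rewrite -(co_mapK kb1 gb (vertex r1) gK) -E1 E2 E12 !co_map_comp.
by apply: co_map_ext => -[x|x] //=; rewrite opairswapK.
Qed.
End Opening.

(** * The value of a presentation in a modular operad *)

Section Evaluation.
Variables (half : bool) (C : cyclic_operad) (M : modular_operad half).
Variable f : cyclic_hom C (genus0 M).
Implicit Types R S T : finType.

(** Defined by recursion so that [mo_contr] takes genus [gen n] to genus [gen n.+1] by conversion,
    without a cast. *)
Fixpoint gen (n : nat) : nat := if n is n'.+1 then gen n' + genus_one half else 0.

(* [ev r m]: contracting the loops of [r] in some order gives [m]. *)
Fixpoint ev (n : nat) S (r : rep C S) {struct n} : M S (gen n) -> Prop :=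
  match n return M S (gen n) -> Prop with
  | 0 => fun m => exists2 y, iso (runit y) r & m = f S y
  | n'.+1 => fun m => exists (r0 : rep C (option (option S))) (m0 : M _ (gen n')),
      [/\ iso (rcontr r0) r, ev r0 m0 & m = mo_contr m0]
  end.

Lemma ev_iso n S (r r' : rep C S) m : iso r r' -> ev r m -> @ev n S r' m.
Proof.
case: n m => [|n] m rr' /=.
  by move=> [y yr ->]; exists y => //; exact: iso_trans yr rr'.
by move=> [r0 [m0 [r0r e0 ->]]]; exists r0, m0; split=> //; exact: iso_trans r0r rr'.
Qed.

Lemma ev_map n S T (g : S -> T) (hg : bijective g) (r : rep C S) m :
  ev r m -> @ev n T (rmap hg r) (mo_map hg m).
Proof.
elim: n S T g hg r m => [|n IH] S T g hg r m /=.
  move=> [y /(iso_map hg) yr ->]; exists (co_map hg y); rewrite ?runit_map //.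
  by rewrite ch_map.
move=> [r0 [m0 [/(iso_map hg) r0r e0 ->]]].
exists (rmap (omap_bij (omap_bij hg)) r0), (mo_map (omap_bij (omap_bij hg)) m0).
by split; [rewrite rcontr_map | exact: IH | rewrite mo_contr_map].
Qed.

Lemma ev_card n S (r : rep C S) m : @ev n S r m -> #|loops r| = n.
Proof.
elim: n S r m => [|n IH] S r m /=.
  by move=> [y /iso_card <- _]; rewrite card_void.
by move=> [r0 [m0 [/iso_card <- /IH r0n _]]]; rewrite card_option r0n.
Qed.

Lemma ev_total n S (r : rep C S) : #|loops r| = n -> exists m, @ev n S r m.
Proof.
elim: n S r => [|n IH] S r rn /=.
  by have [y yr] := iso_unit_ex rn; exists (f S y), y.
have /card_gt0P [l _] : 0 < #|loops r| by rewrite rn.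
have [r0 [k [kb [kl E]]]] := @rep_opens _ _ r l false.
have r0r := iso_opens kl E.
have [|m0 e0] := IH _ r0.
  by apply/eqP; rewrite -eqSS -rn -(iso_card r0r) card_option.
by exists (mo_contr m0), r0, m0.
Qed.

(* Diamond argument: contracting two loops in either order is [mo_contrC]. *)
Lemma ev_inj n S (r : rep C S) m m' : @ev n S r m -> @ev n S r m' -> m = m'.
Proof.
elim: n S r m m' => [|n IH] S r m m' /=.
  move=> [y yr ->] [y' /iso_sym yr' ->]; congr (f S _).
  exact: iso_unit_inj (iso_trans yr yr').
move=> [r1 [m1 [i1 e1 ->]]] [r2 [m2 [i2 e2 ->]]].
have [k1 [kb1 [l1 [c1 [o1 E1]]]]] := opens_iso i1.
have [k2 [kb2 [l2 [c2 [o2 E2]]]]] := opens_iso i2.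
have [l12|/eqP l12] := eqVneq l1 l2.
  rewrite -{}l12 in o2; have [r12|r12] := opens_same o1 o2 E1 E2.
    by rewrite (IH _ _ _ _ (ev_iso r12 e1) e2).
  by rewrite -(IH _ _ _ _ (ev_iso r12 (ev_map _ e1)) e2) mo_contr_sym.
have [r12 [j1 j2]] := opens_diff o1 o2 l12 E1 E2.
case: n {m m'} IH m1 m2 e1 e2 => [|n] IH m1 m2 e1 e2.
  by have := ev_card e2; rewrite -(iso_card j2) card_option.
have [|m12 e12] := @ev_total n _ r12.
  by apply/eqP; rewrite -eqSS -(ev_card e2) -(iso_card j2) card_option.
have -> : m2 = mo_contr m12 by apply: IH e2 _; exists r12, m12.
have -> : m1 = mo_contr (mo_map (opairswap_bij S) m12).
  apply: IH e1 _; eexists; eexists; split; [exact: j1 | exact: ev_map e12 | by []].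
exact: mo_contrC.
Qed.

(** [mo_contr_swap] uses one naming of the inputs, that of [outlr]. Any other [h] differs from it by
    a bijection fixing the two contracted inputs, hence of the form [omap (omap g)], and
    [mo_contr_map] moves [g] outside. *)
Lemma contr_comp_pq R T S (w' : C (option (option R))) (w'' : C (option (option T)))
    (h : option R + option T -> option (option S)) (hb : bijective h) :
  h (inl None) = None -> h (inr None) = Some None ->
  mo_contr (f _ (co_map hb (comp_q w' w'')) : M _ 0) =
  mo_contr (f _ (co_map hb (comp_p w' w'')) : M _ 0).
Proof.
move=> hl hr; case: (outlr_bij R T) => o oK Ko.
have ob : bijective o.
  by exists (fun x : option R + option T => omap (@outr R T) (outl x)).
have o1 : o None = inl None by rewrite -(oK (inl None)).
have o2 : o (Some None) = inr None by rewrite -(oK (inr None)).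
have [|d db dE] := bij_omapP (bij_comp hb ob); first by rewrite /= o1.
have [|g gb gE] := bij_omapP db.
  by have := dE (Some None); rewrite /= o2 hr => -[].
have E (x : C (option R + option T)%type) : co_map hb x =
    co_map (omap_bij (omap_bij gb)) (co_map (outlr_bij R T) x).
  rewrite co_map_comp; apply: co_map_ext => z /=.
  rewrite -[in LHS](oK z); have /= -> := dE (omap (@outr R T) (outl z)).
  by case: (omap (@outr R T) (outl z)) => [y|] //=; rewrite gE.
rewrite !E !ch_map /= !mo_contr_map; congr mo_map.
rewrite /comp_p /comp_q !ch_comp !ch_map.
exact: esym (mo_contr_swap (f _ w' : M _ 0) (f _ w'' : M _ 0)).
Qed.

(* [mo_contr_swap] applies directly when the swapped loop is the only one; since
   contractions commute, any other loop may be contracted last. *)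
Lemma ev_swap n S (r r' : rep C S) m : swap r r' -> @ev n S r m -> ev r' m.
Proof.
elim: n S r r' m => [|n IH] S r r' m sw e.
  have := ev_card e; case: sw => [R [T [L [w' [w'' [h [hb [[l _] -> _]]]]]]]] /card0_eq.
  by move=> /(_ l).
have {sw} [R [T [L [w' [w'' [h [hb [[l [c [hl hr]]] rE ->]]]]]]]] := sw.
subst r; case: (pickP (predC1 l)) => [l' /eqP l'l|noL].
  have [r0 [k [kb [kl E]]]] :=
    @rep_opens _ _ (Rep (co_map hb (comp_q w' w''))) l' false.
  have [g gK Kg] := kb; have gb : bijective g by exists k.
  have r0r := iso_opens kl E.
  have [|m0 e0] := @ev_total n _ r0.
    by apply/eqP; rewrite -eqSS -(ev_card e) -(iso_card r0r) card_option.
  have -> : m = mo_contr m0 by apply: ev_inj e _; exists r0, m0.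
  have [l0 [c0 El0]] := opens_loop c kb kl l'l.
  exists (Rep (co_map gb (co_map hb (comp_p w' w'')))), m0; split=> //.
    apply: (@iso_opens C S (Rep (co_map gb (co_map hb (comp_p w' w''))))
      (Rep (co_map hb (comp_p w' w''))) k kb l' false kl).
    by rewrite /= co_mapK.
  apply: IH e0; exists R, T, (loops r0), w', w'', (g \o h), (bij_comp gb hb).
  split; last by rewrite co_map_comp.
    exists l0, c0; rewrite /= hl hr.
    by split; [have := El0 false | have := El0 true]; rewrite /= => <-; rewrite gK.
  rewrite -co_map_comp; case: r0 k kb g gK Kg gb kl E {r0r l0 El0 m0} => L0 x0 /=.
  by move=> k kb g gK Kg gb _ E; congr Rep; rewrite [co_map hb _]E co_mapK.
have L1 : #|L| = 1.
  by apply: (eq_card1 (x := l)) => x; have := noL x; rewrite !inE => /negbFE.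
have n0 : n = 0 by have := ev_card e; rewrite /loops /= L1 => -[].
subst n; set r := Rep (co_map hb (comp_q w' w'')) in e.
(* Opening the only loop leaves a single operation [y]. With the orientation [c], the inputs p' and
   p'' become [None] and [Some None], as [contr_comp_pq] requires. *)
have [r0 [k [kb [kl E]]]] := @rep_opens _ _ r l c.
have r0r := iso_opens kl E.
have [|y yr0] := @iso_unit_ex _ _ r0.
  by apply/eqP; rewrite -eqSS -L1 -[L]/(loops r) -(iso_card r0r) card_option.
have -> : m = mo_contr (f _ y : M _ 0).
  by apply: ev_inj e _; exists r0, (f _ y); split=> //; exists y.
have [h0 [hb0 [h0l E0]]] := yr0.
have ul := opens_comp kl h0l.
pose u := k \o h0 \o @unit_map _; have ub := bij_comp (bij_comp kb hb0) (unit_map_bij _).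
have Ey : co_map hb (comp_q w' w'') = co_map ub y.
  by rewrite [LHS]E E0 !co_map_comp; apply: co_map_ext.
have [g gK Kg] := ub; have gb : bijective g by exists u.
have [_ u2 u3 _] := ul.
have yE : y = co_map (bij_comp gb hb) (comp_q w' w'').
  by rewrite -co_map_comp Ey co_mapK.
rewrite yE contr_comp_pq.
- pose y' := co_map (bij_comp gb hb) (comp_p w' w''); exists (runit y'), (f _ y'); split=> //.
    apply: (@iso_opens C S (runit y') (Rep (co_map hb (comp_p w' w'')))
      _ (bij_comp kb hb0) l c ul).
    rewrite /= /y' !co_map_comp; apply: co_map_ext => x /=.
    exact: esym (Kg (h x)).
  by exists y' => //; exact: iso_refl.
- by rewrite /= hl -u2; exact: gK None.
- by rewrite /= hr -u3; exact: gK (Some None).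
Qed.

End Evaluation.

(** * Evaluation in arbitrary genus and its compatibility with the operations *)

Section GradedEvaluation.
Variables (half : bool) (C : cyclic_operad) (M : modular_operad half).
Variable f : cyclic_hom C (genus0 M).
Implicit Types R S T : finType.

(** A composite lies in genus [gen n1 + gen n2], which is equal but not convertible to
    [gen (n1 + n2)]; hence the free [G] and the cast. *)
Definition evaluates S (r : rep C S) (G : nat) (m : M S G) : Prop :=
  exists n (e : gen half n = G) m0,
    @ev half C M f n S r m0 /\ m = ecast G (M S G) e m0.

Lemma evaluates_ecast S (r : rep C S) G G' (e : G = G') (m : M S G) :
  evaluates r m -> evaluates r (ecast G (M S G) e m).
Proof. by case: _ / e. Qed.

Lemma evaluates_iso S (r r' : rep C S) G (m : M S G) :
  iso r r' -> evaluates r m -> evaluates r' m.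
Proof.
by move=> rr' [n [e [m0 [em ->]]]]; exists n, e, m0; split=> //; exact: ev_iso em.
Qed.

Lemma evaluates_swap S (r r' : rep C S) G (m : M S G) :
  swap r r' -> evaluates r m -> evaluates r' m.
Proof.
by move=> rr' [n [e [m0 [em ->]]]]; exists n, e, m0; split=> //; exact: ev_swap em.
Qed.

Lemma evaluates_inj S (r : rep C S) G (m m' : M S G) :
  evaluates r m -> evaluates r m' -> m = m'.
Proof.
move=> [n [e [m0 [em ->]]]] [n' [e' [m0' [em' ->]]]].
have n'n : n' = n by rewrite -(ev_card em) -(ev_card em').
subst n'; rewrite (eq_irrelevance e' e); congr (ecast G (M S G) e _).
exact: ev_inj em em'.
Qed.

Lemma evaluates_unit S (y : C S) : evaluates (runit y) (f S y : M S 0).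
Proof. by exists 0, erefl, (f S y); split=> //; exists y => //; exact: iso_refl. Qed.

Lemma evaluates_map S T (g : S -> T) (hg : bijective g) (r : rep C S) G (m : M S G) :
  evaluates r m -> evaluates (rmap hg r) (mo_map hg m).
Proof.
move=> [n [e [m0 [em ->]]]]; case: _ / e.
by exists n, erefl, (mo_map hg m0); split=> //; exact: ev_map.
Qed.

Lemma evaluates_contr S (r : rep C (option (option S))) G (m : M _ G) :
  evaluates r m -> evaluates (rcontr r) (mo_contr m).
Proof.
move=> [n [e [m0 [em ->]]]]; case: _ / e.
exists n.+1, erefl, (mo_contr m0); split=> //.
by exists r, m0; split=> //; exact: iso_refl.
Qed.

Lemma evaluates_compC S1 S2 (r1 : rep C (option S1)) (r2 : rep C (option S2))
    G1 G2 (m1 : M _ G1) (m2 : M _ G2) :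
  evaluates (rcomp r1 r2) (mo_comp m1 m2) -> evaluates (rcomp r2 r1) (mo_comp m2 m1).
Proof.
move=> /(evaluates_map (sumC_bij _ _)) /(evaluates_iso (iso_compC _ _)).
by move=> /(evaluates_ecast (addnC G1 G2)); rewrite mo_compC.
Qed.

(** [mo_contr_comp] moves the contractions of [r1] out of the composite one by one, until a
    presentation without loops remains. Applied on both sides, this reduces [evaluates_comp] to a
    composite of two operations of [C]. *)
Lemma evaluates_comp_unit n S1 S2 (r1 : rep C (option S1)) (r2 : rep C (option S2))
    m1 G2 (m2 : M (option S2) G2) :
  ev f (n := n) r1 m1 ->
  (forall T (y : C (option T)),
     evaluates (rcomp (runit y) r2) (mo_comp (f _ y : M _ 0) m2)) ->
  evaluates (rcomp r1 r2) (mo_comp m1 m2).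
Proof.
elim: n S1 r1 m1 => [|n IH] S1 r1 m1 /=.
  move=> [y yr ->] base; apply: evaluates_iso (base _ y); exact: iso_compl.
move=> [r0 [m0 [r0r e0 ->]]] base.
apply: evaluates_iso (iso_compl r2 r0r) _.
(* In [r0] the inputs to be contracted come first, whereas [mo_contr_comp] starts from an operation
   whose composed input comes first; [o] rotates it to the front. *)
case: (orot_bij S1) => o oK Ko; have ob : bijective o by exists (@orot S1).
have rE : r0 = rmap (orot_bij S1) (rmap ob r0).
  by rewrite rmap_comp (rmap_ext _ (id_bij _)) // rmap_id.
have mE : m0 = mo_map (orot_bij S1) (mo_map ob m0).
  by rewrite mo_map_comp (mo_map_ext _ (id_bij _)) // mo_map_id.
rewrite rE mE -mo_contr_comp; apply: evaluates_ecast.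
apply: evaluates_iso (iso_contr_comp _ _) _; apply: evaluates_contr.
by apply: evaluates_map; apply: IH base; exact: ev_map.
Qed.

Lemma evaluates_comp S1 S2 (r1 : rep C (option S1)) (r2 : rep C (option S2))
    G1 G2 (m1 : M _ G1) (m2 : M _ G2) :
  evaluates r1 m1 -> evaluates r2 m2 -> evaluates (rcomp r1 r2) (mo_comp m1 m2).
Proof.
move=> [n1 [e1 [m1' [ev1 ->]]]] [n2 [e2 [m2' [ev2 ->]]]].
case: _ / e1; case: _ / e2; apply: evaluates_comp_unit ev1 _ => T y.
apply: evaluates_compC; apply: evaluates_comp_unit ev2 _ => T' y'.
apply: evaluates_iso (iso_unit_comp _ _) _.
by have := evaluates_unit (co_comp y' y); rewrite ch_comp.
Qed.
End GradedEvaluation.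

(** * Induction over a modular completion *)

Section Generation.
Variables (half : bool) (M : modular_operad half).
Variable P : forall (S : finType) G, M S G -> Prop.
Hypothesis P_map : forall (S T : finType) G (g : S -> T) (hg : bijective g) (m : M S G),
  P m -> P (mo_map hg m).
Hypothesis P_comp : forall (S1 S2 : finType) G1 G2 (m1 : M (option S1) G1)
  (m2 : M (option S2) G2), P m1 -> P m2 -> P (mo_comp m1 m2).
Hypothesis P_contr : forall (S : finType) G (m : M (option (option S)) G),
  P m -> P (mo_contr m).

Lemma sub_ecast S G G' (e : G = G') (x : {m : M S G | P m}) :
  sval (ecast G {m : M S G | P m} e x) = ecast G (M S G) e (sval x).
Proof. by case: _ / e. Qed.

Definition sub_modular : modular_operad half.
Proof.
refine (@ModularOperad half (fun S G => {m : M S G | P m})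
  (fun S T G f hf x => exist _ (mo_map hf (sval x)) (P_map hf (svalP x)))
  (fun S1 S2 G1 G2 x y =>
     exist _ (mo_comp (sval x) (sval y)) (P_comp (svalP x) (svalP y)))
  (fun S G x => exist _ (mo_contr (sval x)) (P_contr (svalP x)))
  _ _ _ _ _ _ _ _ _ _ _).
- by move=> *; apply: eq_exist; exact: mo_map_ext.
- by move=> S G h [x Px]; apply: eq_exist; exact: mo_map_id.
- by move=> *; apply: eq_exist; exact: mo_map_comp.
- by move=> *; apply: eq_exist; exact: mo_comp_map.
- by move=> *; apply: sig_inj; rewrite sub_ecast /= mo_compC.
- by move=> *; apply: sig_inj; rewrite sub_ecast /= mo_compA.
- by move=> *; apply: eq_exist; exact: mo_contr_map.
- by move=> *; apply: eq_exist; exact: mo_contr_sym.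
- by move=> *; apply: eq_exist; exact: mo_contrC.
- by move=> *; apply: sig_inj; rewrite sub_ecast /= mo_contr_comp.
- by move=> *; apply: eq_exist; exact: mo_contr_swap.
Defined.

Definition sub_modular_incl : modular_hom sub_modular M :=
  @ModularHom half sub_modular M (fun S G x => sval x)
    (fun _ _ _ _ _ _ => erefl) (fun _ _ _ _ _ _ => erefl) (fun _ _ _ => erefl).
End Generation.

Definition modular_hom_comp (half : bool) (L M N : modular_operad half)
    (g : modular_hom M N) (f : modular_hom L M) : modular_hom L N.
Proof.
refine (@ModularHom half L N (fun S G x => g S G (f S G x)) _ _ _) => *.
- by rewrite !mh_map.
- by rewrite !mh_comp.
- by rewrite !mh_contr.
Defined.

Definition modular_hom_id (half : bool) (M : modular_operad half) : modular_hom M M :=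
  @ModularHom half M M (fun S G x => x)
    (fun _ _ _ _ _ _ => erefl) (fun _ _ _ _ _ _ => erefl) (fun _ _ _ => erefl).

(** [mc_unit] factors through the modular suboperad cut out by [P]. The lift of this factorization
    followed by the inclusion is the identity, by uniqueness of lifts, so every element satisfies
    [P]. *)
Lemma modular_completion_ind (half : bool) (Mod : modular_completion half)
    (D : cyclic_operad) (P : forall (S : finType) G, Mod D S G -> Prop) :
  (forall (S T : finType) G (g : S -> T) (hg : bijective g) (m : Mod D S G),
    P _ _ m -> P _ _ (mo_map hg m)) ->
  (forall (S1 S2 : finType) G1 G2 (m1 : Mod D (option S1) G1)
    (m2 : Mod D (option S2) G2), P _ _ m1 -> P _ _ m2 -> P _ _ (mo_comp m1 m2)) ->
  (forall (S : finType) G (m : Mod D (option (option S)) G),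
    P _ _ m -> P _ _ (mo_contr m)) ->
  (forall (S : finType) (x : D S), P S 0 (mc_unit Mod D S x)) ->
  forall (S : finType) G (m : Mod D S G), P S G m.
Proof.
move=> Pm Pc Pk Pu S G m; pose N := sub_modular Pm Pc Pk.
have [u uE] : exists u : cyclic_hom D (genus0 N),
    forall (S : finType) (x : D S), sval (u S x) = mc_unit Mod D S x.
  unshelve eexists (@CyclicHom D (genus0 N)
    (fun S x => exist (P S 0) (mc_unit Mod D S x) (Pu S x)) _ _) => //.
  - by move=> *; apply: eq_exist; rewrite ch_map.
  - by move=> *; apply: eq_exist; rewrite ch_comp.
pose g := modular_hom_comp (sub_modular_incl Pm Pc Pk) (mc_lift Mod u).
have gE := @mc_lift_unique _ Mod D _ (mc_unit Mod D) g.
have iE := @mc_lift_unique _ Mod D _ (mc_unit Mod D) (modular_hom_id (Mod D)).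
rewrite -[m]/(modular_hom_id (Mod D) S G m) iE // -gE; first exact: svalP.
by move=> T x; rewrite /= mc_lift_unit uE.
Qed.

(** * Following chains of moves inside the suboperad *)

Section Injectivity.
Variables (half : bool) (Mod : modular_completion half).
Variables (C : cyclic_operad) (B : cyclic_suboperad C).
Let D := sub_operad B.
Implicit Types R S T L : finType.

Hypothesis dichotomy : forall (R S : finType)
   (w' : C (option (option R))) (w'' : C (option (option S))),
   B _ (comp_q w' w'') ->
   (exists (rho : option R + option S -> option R + option S)
           (hrho : bijective rho),
      (forall r : R, rho (inl (Some r)) = inl (Some r)) /\
      (forall s : S, rho (inr (Some s)) = inr (Some s)) /\
      comp_p w' w'' = co_map hrho (comp_q w' w''))
   \/
   (exists (w1' : C (option (option R))) (w1'' : C (option (option S))),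
      B _ w1' /\ B _ w1'' /\
      comp_p w' w'' = comp_p w1' w1'' /\
      comp_q w' w'' = comp_q w1' w1'').

Definition rincl S (r : rep D S) : rep C S := Rep (sval (vertex r)).

(** A predicate on presentations over [C], so that it can be followed along moves in [C], although
    the value is taken in the completion of the suboperad. *)
Definition presents S G (m : Mod D S G) (t : rep C S) : Prop :=
  exists Bt : B _ (vertex t),
    evaluates (mc_unit Mod D) (Rep (C := D) (exist _ (vertex t) Bt)) m.

Lemma presents_iso S G (m : Mod D S G) (t t' : rep C S) :
  iso t t' -> presents m t -> presents m t'.
Proof.
move=> [h [hb [hl E]]] [Bt em]; have Bt' : B _ (vertex t') by rewrite E; exact: Defs.sub_map.
exists Bt'; apply: evaluates_iso em; apply: (isoI (hb := hb)) => //.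
exact: eq_exist.
Qed.

(** As [rho] fixes all other inputs, it fixes or exchanges the two free ones. Conjugated by [h], it
    therefore fixes all legs and other loops and at most flips the loop [l]. *)
Lemma dichotomy_iso S R T L (w' : C (option (option R))) (w'' : C (option (option T)))
    (h : option R + option T -> S + L * bool) (hb : bijective h)
    (rho : option R + option T -> option R + option T) (hrho : bijective rho) l c :
  h (inl None) = inr (l, c) -> h (inr None) = inr (l, ~~ c) ->
  (forall r, rho (inl (Some r)) = inl (Some r)) ->
  (forall s, rho (inr (Some s)) = inr (Some s)) ->
  comp_p w' w'' = co_map hrho (comp_q w' w'') ->
  iso (Rep (co_map hb (comp_q w' w''))) (Rep (co_map hb (comp_p w' w''))).
Proof.
move=> hl hr rl rr E; have [g gK Kg] := hb; have gb : bijective g by exists h.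
apply: (isoI (hb := bij_comp (bij_comp hb hrho) gb)); last first.
  by rewrite E !co_map_comp; apply: co_map_ext => x /=; rewrite gK.
have fixed x : x <> inr (l, c) -> x <> inr (l, ~~ c) -> h (rho (g x)) = x.
  move=> x1 x2; have gx := Kg x; case E': (g x) gx => [[y|]|[y|]] gx.
  - by rewrite rl.
  - by case: x1; rewrite -hl.
  - by rewrite rr.
  - by case: x2; rewrite -hr.
(* [d] records whether [rho] exchanges the two free inputs, that is, whether [l] is flipped. *)
have [d rho_d] : exists d : bool, forall b : bool,
    rho (if b then inr None else inl None) = if b (+) d then inr None else inl None.
  have inj := bij_inj hrho.
  have noleg x : (if x is inl (Some _) then True else if x is inr (Some _) then True
      else False) -> forall b : bool, rho (if b then inr None else inl None) <> x.
    by case: x => [[r|]|[t|]] // _ []; rewrite -1?[in RHS]rl -1?[in RHS]rr => /inj.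
  have := noleg (rho (inl None)); have := noleg (rho (inr None)).
  case E1: (rho (inl None)) => [[?|]|[?|]]; case E2: (rho (inr None)) => [[?|]|[?|]];
    move=> n2 n1; try by [case: (n1 I false) | case: (n2 I true)].
  - by have /inj : rho (inl None) = rho (inr None) by rewrite E1 E2.
  - by exists false => -[].
  - by exists true => -[].
  - by have /inj : rho (inl None) = rho (inr None) by rewrite E1 E2.
have gl b : g (inr (l, b (+) c)) = if b then inr None else inl None.
  by case: b; rewrite /= -1?hl -1?hr gK.
split=> [s|l'] /=; first exact: fixed.
have [->|/eqP l'l] := eqVneq l' l.
  have gl' b : g (inr (l, b)) = if b (+) c then inr None else inl None.
    by rewrite -gl addbK.
  by exists l, d => b; rewrite gl' rho_d addbAC -gl' Kg.
by exists l', false => b; rewrite fixed ?addbF // => -[].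
Qed.

Lemma presents_swap S G (m : Mod D S G) (t t' : rep C S) :
  swap t t' -> presents m t -> presents m t'.
Proof.
move=> [R [T [L [w' [w'' [h [hb [[l [c [hl hr]]] -> ->]]]]]]]].
have [g gK Kg] := hb; have gb : bijective g by exists h.
move=> pm; have Bq : B _ (comp_q w' w'').
  by case: pm => /= Bt _; rewrite -(co_mapK hb gb (comp_q w' w'') gK); exact: (Defs.sub_map gb Bt).
case: (dichotomy Bq) => [[rho [hrho [rl [rr E]]]]|].
  exact: presents_iso (dichotomy_iso hb hl hr rl rr E) pm.
move=> [w1' [w1'' [B' [B'' [-> qE]]]]]; rewrite {}qE in pm; case: pm => Bt em.
have Bt' : B _ (co_map hb (comp_p w1' w1'')).
  by apply: Defs.sub_map; exact: sub_comp.
exists Bt'; apply: evaluates_swap em.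
pose v' : D _ := exist _ w1' B'; pose v'' : D _ := exist _ w1'' B''.
exists R, T, L, v', v'', h, hb; split.
- by exists l, c.
- by congr Rep; exact: eq_exist.
- by congr Rep; exact: eq_exist.
Qed.

(** The invariant separating elements: it factors through the map under study, so elements with
    equal images have equal classes. *)
Definition classify S G (m : Mod D S G) : rep C S -> Prop :=
  sval (mc_lift Mod (loop_unit half C) S G (mc_hom Mod (sub_incl B) S G m)).

(** A single presentation over the suboperad both evaluates to [m] and represents its class over
    [C]. Both properties pass through relabelling, composition and contraction, so induction from
    the unit applies. *)
Lemma presentation S G (m : Mod D S G) :
  exists r, evaluates (mc_unit Mod D) r m /\ classify m = equiv (rincl r).
Proof.
move: S G m; apply: (@modular_completion_ind _ Mod D (fun S G m =>
  exists r, evaluates (mc_unit Mod D) r m /\ classify m = equiv (rincl r))).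
- move=> S T G g hg m [r [er cr]]; exists (rmap hg r).
  by split; [exact: evaluates_map | rewrite /classify !mh_map; exact: (sval_lmap hg cr)].
- move=> S1 S2 G1 G2 m1 m2 [r1 [er1 cr1]] [r2 [er2 cr2]]; exists (rcomp r1 r2).
  by split; [exact: evaluates_comp | rewrite /classify !mh_comp; exact: (sval_lcomp cr1 cr2)].
- move=> S G m [r [er cr]]; exists (rcontr r).
  by split; [exact: evaluates_contr | rewrite /classify !mh_contr; exact: (sval_lcontr cr)].
- move=> S x; exists (runit x); split; first exact: evaluates_unit.
  by rewrite /classify /mc_hom !mc_lift_unit.
Qed.

(** An equivalence rather than an implication, because chains may use a move backwards; a reversed
    swap is again a swap, so the dichotomy applies to it as well. *)
Lemma presents_equiv S G (m : Mod D S G) (t t' : rep C S) :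
  equiv t t' -> presents m t <-> presents m t'.
Proof.
elim=> {t t'} [t t'|t|t t' _ IH|t t' t'' _ IH _ IH'] //; last 1 first.
- by rewrite IH IH'.
- case=> [tt'|tt']; split.
  + exact: presents_iso.
  + exact/presents_iso/iso_sym.
  + exact: presents_swap.
  + exact/presents_swap/swap_sym.
- by rewrite IH.
Qed.

Lemma mc_hom_inj S G : injective (mc_hom Mod (sub_incl B) S G).
Proof.
move=> m1 m2 E; have [r1 [e1 c1]] := presentation m1.
have [r2 [e2 c2]] := presentation m2.
have /equiv_eqP r12 : equiv (rincl r1) = equiv (rincl r2) by rewrite -c1 -c2 /classify E.
have P S' G' (m : Mod D S' G') r : presents m (rincl r) <-> evaluates (mc_unit Mod D) r m.
  case: r => L [x Bx]; split=> [[Bt]|em]; last by exists Bx.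
  by rewrite /= (Prop_irrelevance Bt Bx).
(* The element [m1] is carried from [r1] to the other end of the chain, so [r2] evaluates to [m1] as
   well as to [m2]. *)
have := (P _ _ _ r1).2 e1; rewrite (presents_equiv _ r12) P => e21.
exact: evaluates_inj e21 e2.
Qed.
End Injectivity.

Theorem proposition41 (half : bool) (Mod : modular_completion half)
  (C : cyclic_operad) (B : cyclic_suboperad C) :
  (forall (R S : finType)
     (w' : C (option (option R))) (w'' : C (option (option S))),
     B _ (comp_q w' w'') ->
     (exists (rho : option R + option S -> option R + option S)
             (hrho : bijective rho),
        (forall r : R, rho (inl (Some r)) = inl (Some r)) /\
        (forall s : S, rho (inr (Some s)) = inr (Some s)) /\
        comp_p w' w'' = co_map hrho (comp_q w' w''))
     \/
     (exists (w1' : C (option (option R))) (w1'' : C (option (option S))),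
        B _ w1' /\ B _ w1'' /\
        comp_p w' w'' = comp_p w1' w1'' /\
        comp_q w' w'' = comp_q w1' w1'')) ->
  forall (S : finType) (G : nat),
    injective (mc_hom Mod (sub_incl B) S G).
Proof. by move=> dichotomy; exact: mc_hom_inj. Qed.
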